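(* Let $\mathcal{A},\mathcal{C}\in\mathbb{C}^{n\times n\times p}$ and let $f$ be a scalar function that is $2np-1$ times continuously differentiable on a region containing $\operatorname{spec}(\mathrm{bcirc}(\mathcal{A}))$. Let $$(F_p\otimes I_n)\,\mathrm{bcirc}(\mathcal{A})\,(F_p^H\otimes I_n)=\mathcal{D}^A,\qquad (F_p\otimes I_n)\,\mathrm{bcirc}(\mathcal{C})\,(F_p^H\otimes I_n)=\mathcal{D}^C,$$ with $\mathcal{D}^A=\mathrm{blkdiag}(D^A_1,\dots,D^A_p)$ and $\mathcal{D}^C=\mathrm{blkdiag}(D^C_1,\dots,D^C_p)$, where all $D_i^A,D_i^C\in\mathbb{C}^{n\times n}$. Then $$L_f(\mathcal{A},\mathcal{C})=\mathrm{fold}\left((F_p^H\otimes I_n)\begin{bmatrix}\frac{1}{\sqrt p}L_1\\ \vdots\\ \frac{1}{\sqrt p}L_p\end{bmatrix}\right),$$ where $L_i=L_f(D^A_i,D^C_i)$ (Fréchet derivative of the matrix function $f$ at $D_i^A$ in direction $D_i^C$) for $i=1,\dots,p$.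
   Context: For a tensor $\mathcal{A}\in\mathbb{C}^{n\times m\times p}$ with frontal slices $A^{(1)},\dots,A^{(p)}\in\mathbb{C}^{n\times m}$, $\mathrm{unfold}(\mathcal{A})\in\mathbb{C}^{np\times m}$ is the block column with blocks $A^{(1)},\dots,A^{(p)}$, and $\mathrm{fold}$ is its inverse. $\mathrm{bcirc}(\mathcal{A})$ is the block circulant matrix whose first block column is $\mathrm{unfold}(\mathcal{A})$, i.e. its $(r,s)$ block is $A^{(((r-s)\bmod p)+1)}$. $\boldsymbol{E}_1=\boldsymbol{e}_1\otimes I_n\in\mathbb{C}^{np\times n}$. For a square matrix $M$, $f(M)$ is the usual (primary) matrix function; the tensor t-function is $f(\mathcal{A}):=\mathrm{fold}(f(\mathrm{bcirc}(\mathcal{A}))\boldsymbol{E}_1)$. For both matrix functions and t-functions, $L_f(X,\cdot)$ denotes the Fréchet derivative at $X$: the linear map with $f(X+E)-f(X)=L_f(X,E)+o(\|E\|)$ (for tensors, the norm is the Frobenius norm, the square root of the sum of squared moduli of the entries). $F_p\in\mathbb{C}^{p\times p}$ is the unitary discrete Fourier transform matrix, with entries $p^{-1/2}e^{-2\pi \mathrm{i}(j-1)(k-1)/p}$; conjugation by $F_p\otimes I_n$ block-diagonalizes every block circulant matrix with $n\times n$ blocks. $\mathrm{blkdiag}$ places its matrix arguments on the block diagonal. *)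

(* Defs.v *)
From HB Require Import structures.
From mathcomp Require Import all_boot all_order all_algebra.
From mathcomp Require Import mxtens complex.
From mathcomp Require Import boolp classical_sets reals topology normedtype.
From mathcomp Require Import derive trigo.

Set Implicit Arguments.
Unset Strict Implicit.
Unset Printing Implicit Defensive.

Import Order.TTheory GRing.Theory Num.Theory.
Import numFieldNormedType.Exports.

Local Open Scope classical_set_scope.
Local Open Scope ring_scope.

(* The complex numbers, packed so that the generic topology, norm and
   complex derivative of a [numClosedFieldType] are inferred. *)
Definition Cx (R : realType) : numClosedFieldType := R[i].

(* Indexed by frontal slices: A k i j is the entry (i, j) of the k-th slice. *)
Definition tensor (C : numClosedFieldType) (n m p : nat) : Type :=
  {ffun 'I_p -> 'M[C]_(n, m)}.

Section Frobenius.
Variables (C : numClosedFieldType) (n m p : nat).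

HB.instance Definition _ := GRing.Lmodule.copy (tensor C n m p)
  {ffun 'I_p -> 'M[C]_(n, m)}.

Implicit Types X Y : tensor C n m p.

Definition frob X : C := sqrtC (\sum_k \sum_i \sum_j `|X k i j| ^+ 2).

Fact sum_cauchy (I : finType) (a b : I -> C) :
  (forall i, 0 <= a i) -> (forall i, 0 <= b i) ->
  \sum_i a i * b i <=
    sqrtC (\sum_i a i ^+ 2) * sqrtC (\sum_i b i ^+ 2).
Proof.
move=> a0 b0.
have s0 (c : I -> C) : (forall i, 0 <= c i) -> 0 <= \sum_i c i ^+ 2.
  by move=> c0; apply: sumr_ge0 => i _; rewrite exprn_ge0.
have ab0 : 0 <= \sum_i a i * b i by apply: sumr_ge0 => i _; rewrite mulr_ge0.
have sab0 : 0 <= sqrtC (\sum_i a i ^+ 2) * sqrtC (\sum_i b i ^+ 2).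
  by rewrite mulr_ge0 ?sqrtC_ge0 ?s0.
rewrite -(@ler_pXn2r _ 2) ?nnegrE // exprMn !sqrtCK.
rewrite -(@ler_pMn2r _ 2) // expr2 !big_distrlr /=.
rewrite [leRHS]mulr2n [X in _ <= _ + X]exchange_big /= -big_split -sumrMnl /=.
apply: ler_sum => i _; rewrite -big_split -sumrMnl /=.
apply: ler_sum => j _.
have r1 : a i * b j \is Num.real by rewrite ger0_real ?mulr_ge0.
have r2 : a j * b i \is Num.real by rewrite ger0_real ?mulr_ge0.
have [le_mean _] := real_leif_mean_square_scaled r1 r2.
by rewrite mulrACA [b i * b j]mulrC mulrACA -!exprMn.
Qed.

Fact sum_minkowski (I : finType) (x y : I -> C) :
  sqrtC (\sum_i `|x i + y i| ^+ 2) <=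
    sqrtC (\sum_i `|x i| ^+ 2) + sqrtC (\sum_i `|y i| ^+ 2).
Proof.
have s0 (c : I -> C) : 0 <= \sum_i `|c i| ^+ 2.
  by apply: sumr_ge0 => i _; rewrite exprn_ge0.
rewrite -(@ler_pXn2r _ 2) ?nnegrE ?addr_ge0 ?sqrtC_ge0 ?s0 //.
rewrite sqrrD !sqrtCK.
apply: (@le_trans _ _ (\sum_i (`|x i| + `|y i|) ^+ 2)).
  apply: ler_sum => i _.
  by rewrite ler_pXn2r ?nnegrE ?addr_ge0 ?normr_ge0 ?ler_normD.
under eq_bigr => i _ do rewrite sqrrD.
rewrite !big_split /= lerD2r lerD2l.
by rewrite [leRHS]mulr2n lerD ?sum_cauchy.
Qed.

Fact frobE X : frob X =
  sqrtC (\sum_(t : 'I_p * ('I_n * 'I_m)) `|X t.1 t.2.1 t.2.2| ^+ 2).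
Proof.
rewrite /frob; congr sqrtC; under eq_bigr => k _ do rewrite pair_bigA.
by rewrite pair_bigA.
Qed.

Fact frob_triangle X Y : frob (X + Y) <= frob X + frob Y.
Proof.
rewrite !frobE; under eq_bigr => t _ do rewrite ffunE mxE.
exact: sum_minkowski.
Qed.

Fact frobZ (l : C) X : frob (l *: X) = `|l| * frob X.
Proof.
rewrite !frobE.
under eq_bigr => t _ do rewrite ffunE mxE normrM exprMn.
rewrite -mulr_sumr rootCMl ?exprn_ge0 //.
by rewrite sqrCK.
Qed.

Fact frob_eq0 X : frob X = 0 -> X = 0.
Proof.
rewrite frobE => /eqP; rewrite sqrtC_eq0 psumr_eq0 => [/allP h|t _]; last first.
  by rewrite exprn_ge0.
apply/ffunP => k; apply/matrixP => i j; rewrite ffunE mxE.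
have /= := h (k, (i, j)); rewrite mem_index_enum => /(_ isT).
by rewrite expf_eq0 normr_eq0 => /eqP.
Qed.

HB.instance Definition _ := Lmodule_isNormed.Build C (tensor C n m p)
  frob_triangle frobZ frob_eq0.

End Frobenius.

Section Blocks.
Variable C : numClosedFieldType.

(* Row (k, i) of a p x 1 arrangement of n-row blocks is row k * n + i, the
   indexing [mxtens_index] of the Kronecker product [*t]. *)
Definition blkcol n m p (B : 'I_p -> 'M[C]_(n, m)) : 'M[C]_(p * n, m) :=
  \matrix_(r, j) B (mxtens_unindex r).1 (mxtens_unindex r).2 j.

Definition blkdiag n p (B : 'I_p -> 'M[C]_n) : 'M[C]_(p * n) :=
  \sum_k delta_mx k k *t B k.

Definition unfold n m p (A : tensor C n m p) : 'M[C]_(p * n, m) := blkcol A.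

Definition fold n m p (X : 'M[C]_(p * n, m)) : tensor C n m p :=
  [ffun k => \matrix_(i, j) X (mxtens_index (k, i)) j].

Fact unfoldK n m p : cancel (@unfold n m p) (@fold n m p).
Proof.
move=> A; apply/ffunP => k; apply/matrixP => i j.
by rewrite !ffunE !mxE mxtens_indexK.
Qed.

Fact cyc_sub_subproof p (r s : 'I_p) : ((r + (p - s)) %% p < p)%N.
Proof. by rewrite ltn_pmod // (leq_ltn_trans _ (ltn_ord r)). Qed.

(* (r - s) mod p *)
Definition cyc_sub p (r s : 'I_p) : 'I_p := Ordinal (cyc_sub_subproof r s).

Definition bcirc n m p (A : tensor C n m p) : 'M[C]_(p * n, p * m) :=
  \matrix_(r, s) A (cyc_sub (mxtens_unindex r).1 (mxtens_unindex s).1)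
                   (mxtens_unindex r).2 (mxtens_unindex s).2.

(* e_1 (x) I_n, with e_1 the first unit vector of length p *)
Definition E1 n p : 'M[C]_(p * n, n) :=
  \matrix_(r, j) (((mxtens_unindex r).1 == 0 :> nat)%:R
                  * (1%:M : 'M[C]_n) (mxtens_unindex r).2 j).

End Blocks.

Section Functions.
Variable C : numClosedFieldType.

Definition spec n (M : 'M[C]_n) : set C := [set a | eigenvalue M a].

(* f is k times continuously (complex) differentiable on the open set U *)
Definition cont_diff_on (k : nat) (U : set C) (f : C -> C) : Prop :=
  [/\ open U,
      forall (j : nat) (z : C), (j < k)%N -> U z -> derivable (derive1n j f) z 1
    & forall (j : nat) (z : C), (j <= k)%N -> U z ->
        {for z, continuous (derive1n j f)}].

(* q takes the values of f on the spectrum of M; the multiplicity of an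
   eigenvalue a in the minimal polynomial is the size of the largest Jordan
   block of M at a. *)
Definition hermite_interp n (f : C -> C) (M : 'M[C]_n.+1) (q : {poly C}) :=
  forall (a : C) (j : nat), root (mxminpoly M) a ->
    (j < mup a (mxminpoly M))%N -> (derivn j q).[a] = derive1n j f a.

(* The primary matrix function f(M) := q(M), for any q interpolating f on the
   spectrum of M; the value does not depend on q. The default 0 of [xget] is
   never reached, and the match only accommodates [horner_mx]. *)
Definition mxfun (f : C -> C) n : 'M[C]_n -> 'M[C]_n :=
  match n with
  | 0 => fun M => M
  | _.+1 => fun M =>
      xget 0 [set B | exists2 q, hermite_interp f M q & B = horner_mx M q]
  end.

Definition tfun (f : C -> C) n p (A : tensor C n n p) : tensor C n n p :=
  fold (mxfun f (bcirc A) *m E1 C n p).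

End Functions.

Arguments mxfun {C} f {n} M.
Arguments tfun {C} f {n p} A.

Definition dft (R : realType) (p : nat) : 'M[Cx R]_p :=
  \matrix_(j, k) ((sqrtC p%:R)^-1 *
    let t : R := 2 * pi * (j * k)%:R / p%:R in
    (cos (- t) +i* sin (- t))%C).

Definition ctrmx (C : numClosedFieldType) m n (M : 'M[C]_(m, n)) : 'M[C]_(n, m) :=
  map_mx Num.conj M^T.

(* Main.v *)
Require Import Defs.
From HB Require Import structures.
From mathcomp Require Import all_boot all_order all_algebra.
From mathcomp Require Import perm mxtens complex.
From mathcomp Require Import boolp classical_sets functions reals topology normedtype.
From mathcomp Require Import interval_inference landau derive trigo ring.
Set Implicit Arguments.
Unset Strict Implicit.
Unset Printing Implicit Defensive.
Import Order.TTheory GRing.Theory Num.Theory.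
Import numFieldNormedType.Exports.
Local Open Scope classical_set_scope.
Local Open Scope ring_scope.

(** Conjugation by the Fourier matrix turns [bcirc B] into the block diagonal
    matrix of the Fourier combinations [dft_block B k] of the slices of [B], for
    every tensor [B] at once ([dft_bcirc], [dft_unitary]).  A primary matrix
    function is a polynomial in its argument, hence commutes with similarities
    and with block diagonals ([mxfun_conj], [mxfun_blkdiag]), and the Fourier
    matrix maps [E1] to a block column of multiples of the identity.  So the
    t-function is a finite sum of compositions: a linear map [dft_block], then
    [mxfun f] on n x n matrices, then a linear map [lift_block] ([tfunE]).  The
    formula for its derivative is the chain rule, once [mxfun f] is known to be
    Frechet differentiable at every diagonal block of the transformed tensor.

    Differentiability of [mxfun f] at an n x n matrix X whose spectrum lies in an
    open set where f has 2n - 1 continuous derivatives is the analytic core.  Let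
    q be a polynomial that osculates f to order 2n at every eigenvalue of X.
    Since q(Y) is polynomial in the entries of Y and q(X) = f(X), it suffices
    that g = f - q satisfies g(X + E) = o(|E|)
    ([mxfun_osculating_littleo]).  Three estimates give this.
    - g and its derivatives are small near the spectrum: the j-th derivative is
      o(|z - a|^(2n-1-j)) at an eigenvalue a ([flat_jet]).
    - Every eigenvalue of X + E is within rho of an eigenvalue of X, where
      rho^n = O(|E|); this follows from multiplying an eigenvector of X + E by
      the adjugate of mu - X ([eigenvalue_perturb]).
    - The polynomial of degree less than n that interpolates g at the eigenvalues
      of X + E has coefficients bounded by a constant times the largest value of
      the derivatives of g of order less than n on the discs of radius rho about
      the spectrum of X ([newton_coef_le]).
    Together the coefficients are o(rho^(2n-1-(n-1))) = o(rho^n) = o(|E|), and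
    g(X + E) is that polynomial evaluated at X + E.

    The third estimate must be uniform when interpolation nodes collide, and it
    has to be proved with complex derivatives only.  Newton's form of the
    interpolant reduces it to divided differences g[mu, .], and these are
    controlled, without integrals, by following the path
    t |-> g(mu + t(z - mu)), from t = 1, which is g itself, to t = 0, where g has
    been made constant: on jets, the derivative along the path is
    (z - mu) times a jet bounded by the derivative of g, and the factor z - mu
    removes the node mu from the interpolation problem.  Nodes near
    different eigenvalues of X cannot be joined by a path, but they stay at a
    bounded distance, so there the divided difference is an honest quotient. *)

(** * Hermite interpolation in Newton form *)

Section Newton.
Variable K : numFieldType.
Implicit Types (J H : nat -> K -> K) (s : seq K) (p q r : {poly K}).

(** A function and its derivatives are represented by a jet [J], where [J j a] is
    the j-th derivative at [a].  A node that occurs m times in [s] prescribes the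
    derivatives of order less than m. *)
Definition hermite s J r :=
  forall (a : K) (j : nat), (j < count_mem a s)%N -> (derivn j r).[a] = J j a.

(** The derivatives of z |-> (g z - g mu) / (z - mu) at a point [a <> mu], by
    Leibniz's rule for its product with z - mu. *)
Fixpoint ddiff_off (mu : K) J (a : K) (j : nat) : K :=
  if j is i.+1 then (J j a - j%:R * ddiff_off mu J a i) / (a - mu)
  else (J 0%N a - J 0%N mu) / (a - mu).

(** The jet of the divided difference g[mu, .], continued to mu by its limit. *)
Definition ddiff (mu : K) J : nat -> K -> K := fun j a =>
  if a == mu then J j.+1 mu / j.+1%:R else ddiff_off mu J a j.

Fixpoint newton s J : {poly K} :=
  if s is mu :: s' then (J 0%N mu)%:P + ('X - mu%:P) * newton s' (ddiff mu J)
  else 0.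

(** The jet of z |-> (z - mu) h z, given the jet [H] of h. *)
Definition jetM (mu : K) H : nat -> K -> K := fun j a =>
  (a - mu) * H j a + j%:R * H j.-1 a.

Lemma derivn_XsubCM (mu : K) r (j : nat) :
  derivn j (('X - mu%:P) * r) = ('X - mu%:P) * derivn j r + j%:R * derivn j.-1 r.
Proof.
elim: j => [|j IH]; first by rewrite mul0r addr0.
have jE : j%:R * (derivn j.-1 r)^`() = j%:R * derivn j r.
  by case: j {IH} => [|j]; rewrite ?mul0r // derivnS.
rewrite derivnS IH derivD derivM derivXsubC mul1r -derivnS mulr_natl derivMn.
by rewrite -[X in _ + X]mulr_natl jE -natr1 /=; ring.
Qed.

Lemma derivn_XsubCM_horner (mu a : K) r (j : nat) :
  (derivn j (('X - mu%:P) * r)).[a] = jetM mu (fun i z => (derivn i r).[z]) j a.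
Proof.
rewrite derivn_XsubCM /jetM hornerD hornerM hornerXsubC.
by rewrite mulr_natl hornerMn -mulr_natl.
Qed.

(** Multiplication by z - mu is undone by the divided difference at mu.  Hence
    interpolating (z - mu) h on [mu :: s] amounts to interpolating h on [s]. *)
Lemma ddiff_jetM (mu : K) H : ddiff mu (jetM mu H) = H.
Proof.
apply/funext => j; apply/funext => a; rewrite /ddiff /jetM.
case: eqVneq => [->|amu].
  by rewrite subrr mul0r add0r /= mulrC mulKf ?pnatr_eq0.
have a0 : a - mu != 0 by rewrite subr_eq0.
elim: j => [|j IH] /=.
  by rewrite subrr !mul0r !addr0 subr0 mulrC mulKf.
by rewrite IH addrK mulrC mulKf.
Qed.

Lemma newtonP s J : hermite s J (newton s J).
Proof.
have cS c i : derivn i.+1 c%:P = 0 :> {poly K} by rewrite derivnC.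
elim: s J => [|mu s IH] J a j //=.
rewrite derivnD hornerD derivn_XsubCM_horner /jetM.
case: eqVneq => [<-|amu] /=.
  rewrite add1n ltnS subrr mul0r add0r; case: j => [|j] jc.
    by rewrite derivn0 hornerC mul0r addr0.
  rewrite cS horner0 add0r (IH (ddiff mu J)) // /ddiff eqxx.
  by rewrite mulrC divfK ?pnatr_eq0.
have a0 : a - mu != 0 by rewrite subr_eq0 eq_sym.
rewrite add0n => jc; rewrite (IH (ddiff mu J)) // {1}/ddiff eq_sym (negPf amu).
case: j jc => [|j] jc /=.
  by rewrite hornerC mul0r addr0 mulrC divfK // addrC subrK.
rewrite -derivnS cS horner0 add0r (IH (ddiff mu J) a j (ltnW jc)).
by rewrite /ddiff eq_sym (negPf amu) mulrC divfK ?subrK.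
Qed.

Lemma size_newton s J : (size (newton s J) <= size s)%N.
Proof.
elim: s J => [|a s IH] J /=; first by rewrite size_poly0.
apply: leq_trans (size_polyD _ _) _; rewrite geq_max.
rewrite (leq_trans (size_polyC_leq1 _)) //= (leq_trans (size_polyMleq _ _)) //.
by rewrite size_XsubC /= add0n ltnS.
Qed.

(** Dividing out one factor X - mu turns the conditions on [mu :: s] into those on
    [s], by the same Leibniz relation that defines [ddiff]. *)
Lemma hermite0_dvd s p : hermite s (fun _ _ => 0) p ->
  (\prod_(a <- s) ('X - a%:P)) %| p.
Proof.
elim: s p => [|mu s IH] p hp; first by rewrite big_nil dvd1p.
have : root p mu by apply/rootP; apply: (hp mu 0%N); rewrite /= eqxx.
move=> /factor_theorem[r pE]; rewrite big_cons pE mulrC dvdp_mul2r ?polyXsubC_eq0//.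
apply: IH => a j jc.
have {}hp i : (i < count_mem a (mu :: s))%N ->
    jetM mu (fun i z => (derivn i r).[z]) i a = 0.
  by move=> /hp <-; rewrite pE mulrC derivn_XsubCM_horner.
have [amu|amu] := eqVneq a mu.
  have := hp j.+1; rewrite /= amu eqxx add1n ltnS -amu => /(_ jc) /eqP.
  by rewrite /jetM amu subrr mul0r add0r mulf_eq0 pnatr_eq0 /= => /eqP.
have a0 : a - mu != 0 by rewrite subr_eq0.
rewrite /= eq_sym (negPf amu) add0n in hp.
elim: j jc => [|j IHj] jc; have /eqP := hp _ jc; rewrite /jetM.
  by rewrite mul0r addr0 mulf_eq0 (negPf a0) => /eqP.
by rewrite IHj ?(ltnW jc)// mulr0 addr0 mulf_eq0 (negPf a0) => /eqP.
Qed.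

Lemma hermite_eqmod s J p q : hermite s J p -> hermite s J q ->
  (\prod_(a <- s) ('X - a%:P)) %| (p - q).
Proof.
move=> hp hq; apply: hermite0_dvd => a j jc.
by rewrite derivnB hornerD hornerN hp // hq // subrr.
Qed.

End Newton.

(** * Primary matrix functions as polynomials *)

Section MxFun.
Variable K : numClosedFieldType.
Implicit Types (f : K -> K) (s : seq K) (q : {poly K}).

Definition jets f : nat -> K -> K := fun j => derive1n j f.

(** Evaluation of a polynomial at a square matrix of any size, including 0 and
    sizes such as p * n that are not syntactically successors, where [horner_mx]
    does not apply. *)
Definition mx_horner n q (M : 'M[K]_n) : 'M[K]_n := \sum_(i < size q) q`_i *: M ^+ i.

Lemma mx_hornerE n q (M : 'M[K]_n.+1) : mx_horner q M = horner_mx M q.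
Proof.
rewrite -[in RHS](coefK q) poly_def rmorph_sum /=; apply: eq_bigr => i _.
by rewrite -mul_polyC rmorphM rmorphXn /= horner_mx_X horner_mx_C -mul_scalar_mx.
Qed.

Lemma hermite_dvd s t J q :
  \prod_(a <- t) ('X - a%:P) %| \prod_(a <- s) ('X - a%:P) ->
  hermite s J q -> hermite t J q.
Proof.
move=> ts hs a j jt; apply: hs; apply: leq_trans jt _.
have P0 u : \prod_(b <- u) ('X - b%:P) != 0 :> {poly K}.
  by apply: monic_neq0; apply: monic_prod_XsubC.
by rewrite -!mu_prod_XsubC mup_geq // (dvdp_trans _ ts) // -mup_geq.
Qed.

Lemma hermite_interpE n f (M : 'M[K]_n.+1) t q :
  mxminpoly M = \prod_(a <- t) ('X - a%:P) ->
  hermite_interp f M q <-> hermite t (jets f) q.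
Proof.
move=> Mt; rewrite /hermite_interp Mt; split=> h a j.
  move=> jt; apply: h; last by rewrite mu_prod_XsubC.
  by rewrite root_prod_XsubC -has_pred1 has_count (leq_trans _ jt).
by move=> _; rewrite mu_prod_XsubC; apply: h.
Qed.

(** The minimal polynomial divides every annihilating product, so Hermite data on
    any list of nodes that annihilates M is at least as strong as the data
    required by the definition of [mxfun], and two interpolants agree modulo the
    minimal polynomial. *)
Lemma mxfunE n f (M : 'M[K]_n) s q :
  mx_horner (\prod_(a <- s) ('X - a%:P)) M = 0 -> hermite s (jets f) q ->
  mxfun f M = mx_horner q M.
Proof.
case: n M => [|n] M; first by move=> _ _; apply/matrixP => -[].
rewrite !mx_hornerE => Ms hq.
have [t Mt] := closed_field_poly_normal (mxminpoly M).
rewrite (monicP (mxminpoly_monic M)) scale1r in Mt.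
have ht : hermite t (jets f) q.
  by apply: hermite_dvd hq; rewrite -Mt mxminpoly_min.
rewrite /mxfun; case: xgetP => [B _ [q' /(hermite_interpE _ _ Mt) hq' ->]|].
  apply/eqP; rewrite -subr_eq0 -rmorphB; apply/eqP.
  have := hermite_eqmod hq' ht; rewrite -Mt => /dvdpP[r ->].
  by rewrite rmorphM /= mx_root_minpoly mulr0.
move=> /(_ (horner_mx M q)) []; exists q => //.
exact/(hermite_interpE _ _ Mt).
Qed.

(** Eigenvalues with algebraic multiplicity. *)
Definition eigseq n (M : 'M[K]_n) :=
  sval (closed_field_poly_normal (char_poly M)).

Lemma eigseqE n (M : 'M[K]_n) :
  char_poly M = \prod_(a <- eigseq M) ('X - a%:P).
Proof.
rewrite /eigseq; case: closed_field_poly_normal => s /= {1}->.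
by rewrite (monicP (char_poly_monic M)) scale1r.
Qed.

Lemma size_eigseq n (M : 'M[K]_n) : size (eigseq M) = n.
Proof.
by apply: succn_inj; rewrite -(size_prod_XsubC _ id) -eigseqE size_char_poly.
Qed.

Lemma mem_eigseq n (M : 'M[K]_n) a : (a \in eigseq M) = eigenvalue M a.
Proof.
case: n M => [|n] M.
  rewrite (size0nil (size_eigseq M)) in_nil.
  by apply/esym/negbTE/negP => /eigenvalueP[v _]; rewrite [v]thinmx0 eqxx.
by rewrite eigenvalue_root_char eigseqE root_prod_XsubC.
Qed.

Lemma mx_horner_dvd n q r (M : 'M[K]_n) :
  q %| r -> mx_horner q M = 0 -> mx_horner r M = 0.
Proof.
case: n M => [|n] M; first by move=> _ _; apply/matrixP => -[].
by rewrite !mx_hornerE => /dvdpP[p ->] q0; rewrite rmorphM /= q0 mulr0.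
Qed.

Lemma mx_horner_char_poly n (M : 'M[K]_n) : mx_horner (char_poly M) M = 0.
Proof.
case: n M => [|n] M; first by apply/matrixP => -[].
by rewrite mx_hornerE Cayley_Hamilton.
Qed.

Lemma mxfun_newton n f (M : 'M[K]_n) :
  mxfun f M = mx_horner (newton (eigseq M) (jets f)) M.
Proof.
by apply: (mxfunE _ (@newtonP _ _ _)); rewrite -eigseqE mx_horner_char_poly.
Qed.

Lemma mx_horner_conj n q (M P Q : 'M[K]_n) : Q *m P = 1%:M ->
  mx_horner q (P *m M *m Q) = P *m mx_horner q M *m Q.
Proof.
move=> QP; rewrite /mx_horner mulmx_sumr mulmx_suml; apply: eq_bigr => i _.
rewrite -scalemxAr -scalemxAl; congr (_ *: _).
elim: {i}(i : nat) => [|i IH].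
  by rewrite !expr0 mulmx1 (mulmx1C QP).
by rewrite !exprSr IH -!mulmxE !mulmxA -[_ *m Q *m P]mulmxA QP mulmx1.
Qed.

Lemma mxfun_conj n f (M P Q : 'M[K]_n) : Q *m P = 1%:M ->
  mxfun f (P *m M *m Q) = P *m mxfun f M *m Q.
Proof.
move=> QP; rewrite (mxfun_newton f M) -mx_horner_conj //.
apply: (mxfunE _ (@newtonP _ _ _)).
by rewrite mx_horner_conj // -eigseqE mx_horner_char_poly mulmx0 mul0mx.
Qed.

Lemma blkdiagE n p (B : 'I_p -> 'M[K]_n) k i l j :
  blkdiag B (mxtens_index (k, i)) (mxtens_index (l, j)) =
  if k == l then B k i j else 0.
Proof.
rewrite /blkdiag summxE.
under eq_bigr => m _ do rewrite tensmxE mxE.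
rewrite (bigD1 k) //= eqxx big1 ?addr0 => [|m mk].
  by rewrite [l == k]eq_sym; case: eqP => _ /=; rewrite ?mul1r ?mul0r.
by rewrite [k == m]eq_sym (negPf mk) mul0r.
Qed.

Lemma mulmx_blkdiag n p (B B' : 'I_p -> 'M[K]_n) :
  blkdiag B *m blkdiag B' = blkdiag (fun k => B k *m B' k).
Proof.
rewrite /blkdiag mulmx_suml; apply: eq_bigr => k _.
rewrite mulmx_sumr (bigD1 k) //= big1 ?addr0 => [|l lk].
  by rewrite tensmx_mul mul_delta_mx.
by rewrite tensmx_mul mul_delta_mx_0 ?tens0mx // eq_sym.
Qed.

Lemma blkdiag1 n p : blkdiag (fun _ : 'I_p => 1%:M) = 1%:M :> 'M[K]_(p * n).
Proof.
apply/matrixP => r s.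
rewrite -(mxtens_unindexK r) -(mxtens_unindexK s).
case: (mxtens_unindex r) => k i; case: (mxtens_unindex s) => l j.
rewrite blkdiagE !mxE (can_eq (@mxtens_indexK _ _)) xpair_eqE.
by case: eqP.
Qed.

Lemma blkdiagX n p (B : 'I_p -> 'M[K]_n) i :
  blkdiag B ^+ i = blkdiag (fun k => B k ^+ i).
Proof.
elim: i => [|i IH]; first by rewrite expr0 [LHS](esym (blkdiag1 n p)).
rewrite exprSr IH -mulmxE mulmx_blkdiag.
by congr blkdiag; apply/funext => k; rewrite exprSr.
Qed.

Lemma mx_horner_blkdiag n p q (B : 'I_p -> 'M[K]_n) :
  mx_horner q (blkdiag B) = blkdiag (fun k => mx_horner q (B k)).
Proof.
apply/matrixP => r s; rewrite -(mxtens_unindexK r) -(mxtens_unindexK s).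
case: (mxtens_unindex r) => k i; case: (mxtens_unindex s) => l j.
rewrite blkdiagE !summxE; case: eqP => [<-|kl]; last first.
  by apply: big1 => m _; rewrite blkdiagX mxE blkdiagE (introF eqP kl) mulr0.
by apply: eq_bigr => m _; rewrite blkdiagX !mxE blkdiagE eqxx.
Qed.

(** The eigenvalues of all the blocks together annihilate each block, so a single
    interpolating polynomial serves all blocks at once. *)
Lemma mxfun_blkdiag n p f (B : 'I_p -> 'M[K]_n) :
  mxfun f (blkdiag B) = blkdiag (fun k => mxfun f (B k)).
Proof.
pose s := flatten [seq eigseq (B k) | k <- enum 'I_p].
have sB k : mx_horner (\prod_(a <- s) ('X - a%:P)) (B k) = 0.
  apply: (@mx_horner_dvd _ (char_poly (B k))); last exact: mx_horner_char_poly.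
  rewrite eigseqE big_flatten big_map big_enum /= (bigD1 k) //=.
  exact: dvdp_mulr.
rewrite (@mxfunE _ _ _ s (newton s (jets f))); first last.
- exact: newtonP.
- rewrite mx_horner_blkdiag /blkdiag big1 // => k _.
  by rewrite sB tensmx0.
rewrite mx_horner_blkdiag; congr blkdiag; apply/funext => k.
by rewrite (mxfunE (sB k) (@newtonP _ _ _)).
Qed.

End MxFun.

(** * Complex derivatives relative to a set *)

Section RelativeDerivative.
Variable K : numFieldType.
Implicit Types (D : set K) (g h : K -> K) (l m z : K).

(** Caratheodory's form of differentiability: the difference quotient extends to a
    function continuous at z within D.  The set D need not be open: it is a segment
    for the parameter of a path, and a union of closed discs for the nodes. *)
Definition wderiv D g l z := exists psi : K -> K,
  [/\ psi @ within D (nbhs z) --> psi z, psi z = l &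
      forall w, D w -> g w = g z + psi w * (w - z)].

Lemma cvg_within_id D z : id @ within D (nbhs z) --> z.
Proof. by apply: cvg_within_filter; exact: cvg_id. Qed.

Lemma wderiv_cst D c z : wderiv D (fun _ => c) 0 z.
Proof.
exists (fun _ => 0); split=> // [|w _]; last by rewrite mul0r addr0.
exact: cvg_cst.
Qed.

Lemma wderiv_id D z : wderiv D id 1 z.
Proof.
exists (fun _ => 1); split=> // [|w _]; last by rewrite mul1r addrC subrK.
exact: cvg_cst.
Qed.

Lemma wderiv_add D g h l m z : wderiv D g l z -> wderiv D h m z ->
  wderiv D (fun w => g w + h w) (l + m) z.
Proof.
move=> [ps [cps psz gE]] [ph [cph phz hE]].
exists (fun w => ps w + ph w); split.
- exact: cvgD.
- by rewrite psz phz.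
- by move=> w Dw; rewrite gE // hE // mulrDl addrACA.
Qed.

Lemma wderiv_cvg D g l z : wderiv D g l z -> g @ within D (nbhs z) --> g z.
Proof.
move=> [ps [cps psz gE]].
have H : (fun w => g z + ps w * (w - z)) @ within D (nbhs z) --> g z.
  rewrite -[X in _ --> X]addr0 -(mulr0 (ps z)) -(subrr z).
  apply: cvgD; first exact: cvg_cst.
  apply: cvgM => //; apply: cvgB; [exact: cvg_within_id|exact: cvg_cst].
apply: cvg_trans H; apply: near_eq_cvg.
by rewrite near_withinE; apply: filterE => w Dw /=; rewrite [RHS]gE.
Qed.

Lemma wderiv_mul D g h l m z : wderiv D g l z -> wderiv D h m z ->
  wderiv D (fun w => g w * h w) (l * h z + g z * m) z.
Proof.
move=> dg dh; have cg := wderiv_cvg dg.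
move: dg dh => [ps [cps psz gE]] [ph [cph phz hE]].
exists (fun w => ps w * h z + g w * ph w); split.
- apply: cvgD; last exact: cvgM.
  by apply: cvgM => //; apply: cvg_cst.
- by rewrite psz phz.
- by move=> w Dw; rewrite (hE w Dw) (gE w Dw); ring.
Qed.

Lemma wderiv_comp D D' g h l m z : (forall w, D w -> D' (h w)) ->
  wderiv D' g l (h z) -> wderiv D h m z -> wderiv D (g \o h) (l * m) z.
Proof.
move=> DD' [ps [cps psz gE]] dh; have ch := wderiv_cvg dh.
move: dh => [ph [cph phz hE]].
exists (fun w => ps (h w) * ph w); split.
- apply: cvgM => //; apply: cvg_comp cps.
  move=> A /ch; rewrite /= !nbhs_simpl /within /=.
  by apply: filterS => w DA Dw; apply: DA => //; apply: DD'.
- by rewrite psz phz.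
- move=> w Dw; rewrite /= (gE _ (DD' w Dw)) -mulrA; congr (_ + _ * _).
  by rewrite hE // addrC addKr.
Qed.

Lemma wderiv_inv D g l z :
  wderiv D g l z -> g z != 0 -> (forall w, D w -> g w != 0) ->
  wderiv D (fun w => (g w)^-1) (- l / g z ^+ 2) z.
Proof.
move=> dg gz g0; have cg := wderiv_cvg dg; move: dg => [ps [cps psz gE]].
exists (fun w => - ps w * ((g w)^-1 * (g z)^-1)); split.
- apply: cvgM; first exact: cvgN.
  by apply: cvgM; [exact: cvgV|exact: cvg_cst].
- by rewrite psz -invfM -expr2.
- move=> w Dw; have gw := g0 w Dw.
  have pE : ps w * (w - z) = g w - g z by rewrite (gE w Dw) [RHS]addrC addKr.
  by rewrite mulrAC mulNr pE; field; rewrite gz gw.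
Qed.

(** Functions defined by cases on the component of their argument are
    differentiated one component at a time. *)
Lemma wderiv_local D (V : set K) g h l z : D z -> V z ->
  (\forall w \near z, D w -> V w) -> (forall w, D w -> V w -> g w = h w) ->
  wderiv (D `&` V) g l z -> wderiv D h l z.
Proof.
move=> Dz Vz nV gh [ps [cps psz gE]].
exists (fun w => if `[< V w >] then ps w else (h w - h z) / (w - z)).
rewrite asboolT //; split=> //.
- move=> A /cps; rewrite !nbhs_simpl /within /= => nA.
  apply: filterS2 nA nV => w DA DV Dw.
  by rewrite asboolT; [apply: DA; split=> //|]; apply: DV.
- move=> w Dw; case: asboolP => [Vw|Vw]; first by rewrite -!gh // gE.
  have wz : w - z != 0 by rewrite subr_eq0; apply/eqP => wz; apply: Vw; rewrite wz.
  by rewrite divfK // addrC subrK.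
Qed.

Lemma wderiv_sub D D' g l z : D `<=` D' -> wderiv D' g l z -> wderiv D g l z.
Proof.
move=> DD' [ps [cps psz gE]]; exists ps; split=> // [|w /DD'/gE//].
apply: cvg_trans cps; apply: cvg_app.
move=> A; rewrite !nbhs_simpl /within /= => dA.
by apply: filterS dA => w DA /DD'; apply: DA.
Qed.

Lemma wderiv_derivable g z : derivable g z 1 -> wderiv setT g (derive1 g z) z.
Proof.
move=> dg.
exists (fun w => if w == z then derive1 g z else (g w - g z) / (w - z)).
rewrite eqxx; split; [|by []|move=> w _]; last first.
  case: eqVneq => [->|wz]; first by rewrite subrr mulr0 addr0.
  by rewrite divfK ?subr_eq0 // addrC subrK.
apply: cvg_within_filter; apply/cvgrPdist_lt => e e0.
have /cvgrPdist_lt/(_ e e0) :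
    (fun h : K => h^-1 * (g (h + z) - g z)) @ 0^' --> derive1 g z.
  rewrite derive1E (_ : (fun h : K => h^-1 * _) = (fun h : K =>
    h^-1 *: (((g \o shift z) (h *: (1 : K^o)) : K^o) - g z))); first exact: dg.
  by apply/funext => h /=; rewrite [h%:A]mulr1.
rewrite near_withinE => /nbhs_ballP[d /= d0 dH].
apply/nbhs_ballP; exists d => //= w zw.
case: eqVneq => [_|wz]; first by rewrite subrr normr0.
have := dH (w - z); rewrite subrK [_^-1 * _]mulrC; apply.
  by move: zw; rewrite -!ball_normE /= sub0r opprB.
by rewrite subr_eq0.
Qed.

Lemma wderiv_scale D g l z c : wderiv D g l z -> wderiv D (fun w => c * g w) (c * l) z.
Proof.
by move=> dg; have := wderiv_mul (wderiv_cst D c z) dg; rewrite mul0r add0r.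
Qed.

Lemma wderiv_exp D z j : wderiv D (fun w => w ^+ j) (j%:R * z ^+ j.-1) z.
Proof.
elim: j => [|j IH]; first by rewrite mul0r; exact: wderiv_cst.
under eq_fun do rewrite exprS.
have := wderiv_mul (wderiv_id D z) IH; rewrite mul1r mulrCA -exprS /=.
case: j {IH} => [|j]; first by rewrite mul0r addr0 expr0 mul1r.
by rewrite /= -[X in X + _]mul1r -mulrDl addrC natr1.
Qed.

Lemma wderiv_horner D z (p : {poly K}) : wderiv D (fun w => p.[w]) (p^`()).[z] z.
Proof.
elim/poly_ind: p => [|p c IH].
  by under eq_fun do rewrite horner0; rewrite deriv0 horner0; exact: wderiv_cst.
under eq_fun do rewrite !hornerE.
have := wderiv_add (wderiv_mul IH (wderiv_id D z)) (wderiv_cst D c z).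
by rewrite addr0 mulr1 derivD derivC addr0 derivM derivX mulr1 hornerD hornerMX.
Qed.

End RelativeDerivative.

(** * Mean value inequality along a segment *)

Section MeanValue.
Variable R : realType.
Local Notation K := (Cx R).
Local Notation Re := complex.Re.

Definition unit_seg : set K := [set t | 0 <= t <= 1].

Lemma Re_within_cvg (g : K -> K) (x : R) :
  g @ within unit_seg (nbhs (x%:C%C : K)) --> g x%:C%C ->
  (fun y : R => Re (g y%:C%C)) @ within `[0, 1] (nbhs x) --> Re (g x%:C%C).
Proof.
move=> cg; apply/cvgrPdist_lt => e e0.
have e0' : 0 < (e%:C%C : K) by rewrite ltcR.
move/cvgrPdist_lt: cg => /(_ _ e0'); rewrite !near_withinE.
move=> /nbhs_ballP[d /= d0 dH].
have dE : d = (Re d)%:C%C by rewrite RRe_real // gtr0_real.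
have Rd0 : 0 < Re d by rewrite -ltcR -dE.
near=> y => /=; rewrite in_itv /= => y01.
rewrite -ltcR; apply: le_lt_trans (dH y%:C%C _ _).
- rewrite -raddfB; exact: normc_ge_Re.
- rewrite /ball /= -rmorphB /= normc_def /= expr0n /= addr0 sqrtr_sqr dE ltcR.
  by near: y; apply: nbhsx_ballx.
- by rewrite /unit_seg /= ler0c -[1]/((1%:C)%C : K) lecR.
Unshelve. all: by end_near.
Qed.

Lemma ReMr (z : K) (r : R) : Re (z * r%:C%C) = r * Re z.
Proof. by case: z => a b /=; rewrite mulr0 subr0 mulrC. Qed.

(** Rotate the increment phi 1 - phi 0 onto the positive real axis and apply the
    real mean value theorem to the real part of the rotated function. *)
Lemma mean_value_le (phi dphi : K -> K) (M : K) :
  (forall t, unit_seg t -> wderiv unit_seg phi (dphi t) t) ->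
  (forall t, unit_seg t -> `|dphi t| <= M) -> `|phi 1 - phi 0| <= M.
Proof.
move=> dp dM; have M0 : 0 <= M.
  by apply: le_trans (dM 0 _); rewrite ?normr_ge0 // /unit_seg /= lexx ler01.
have [->|De0] := eqVneq (phi 1 - phi 0) 0; first by rewrite normr0.
pose c : K := `|phi 1 - phi 0| / (phi 1 - phi 0).
have c1 : `|c| = 1.
  by rewrite normrM normfV normr_id divff // normr_eq0.
have dcp t : unit_seg t -> wderiv unit_seg (fun w => c * phi w) (c * dphi t) t.
  move=> tI; have := wderiv_mul (wderiv_cst unit_seg c t) (dp t tI).
  by rewrite mul0r add0r.
have in01 (x : R) : 0 <= x <= 1 -> unit_seg x%:C%C.
  by rewrite /unit_seg /= ler0c -[1 in X in _ -> X]/((1%:C)%C : K) lecR.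
pose F (y : R) := Re (c * phi y%:C%C).
have [] := @MVT R F (fun x => Re (c * dphi x%:C%C)) 0 1 ltr01.
- move=> x; rewrite in_itv /= => /andP[x0 x1].
  have xI := in01 x; rewrite !ltW // in xI; have {}xI := xI isT.
  have [ps [cps psx pE]] := dcp _ xI.
  have cF : (fun h => h^-1 *: ((F \o shift x) (h *: (1 : R^o)) - F x : R^o)) @ 0^' -->
     Re (c * dphi x%:C%C).
    apply/cvgrPdist_lt => e e0; rewrite near_withinE.
    have x01 : \forall y \near x, y \in `]0, 1[.
      by apply: near_in_itvoo; rewrite in_itv /= x0.
    have /cvgrPdist_lt/(_ e e0) := Re_within_cvg cps; rewrite psx near_withinE.
    move=> H; have := filterI x01 H; rewrite -nbhs_ballE => -[d /= d0 dH].
    apply/nbhs_ballP; exists d => //= h; rewrite /ball_ /= sub0r normrN => h_lt h0.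
    have [|yI] := dH (h + x).
      by rewrite -ball_normE /= opprD addrCA subrr addr0 normrN.
    rewrite in_itv /= in yI; case/andP: yI => y0 y1.
    rewrite in_itv /= !ltW // => /(_ isT).
    have FE : F (h + x) - F x = h * Re (ps (h + x)%:C%C).
      rewrite /F -raddfB /= (pE (h + x)%:C%C); last by apply: in01; rewrite !ltW.
      by rewrite addrAC subrr add0r -rmorphB addrK ReMr.
    by rewrite [h *: _]mulr1 FE [_ *: _]mulKf.
  by split; [apply/cvg_ex; eexists; exact: cF|exact: cvg_lim cF].
- apply/subspace_continuousP => x /=; rewrite in_itv /= => xI.
  exact: (@Re_within_cvg (fun w => c * phi w) x (wderiv_cvg (dcp _ (in01 _ xI)))).
- move=> t; rewrite in_itv /= => /andP[t0 t1]; rewrite subr0 mulr1 /F.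
  rewrite -raddfB -mulrBr divfK // => E.
  have tI := in01 t; rewrite !ltW // in tI; have {}tI := tI isT.
  have : (Re `|phi 1 - phi 0|)%:C%C = `|phi 1 - phi 0|.
    by rewrite RRe_real // normr_real.
  move<-; rewrite E; apply: le_trans (dM _ tI).
  rewrite -[leRHS]mul1r -c1 -normrM; apply: le_trans (normc_ge_Re _).
  by rewrite lecR ler_norm.
Qed.

End MeanValue.
Arguments unit_seg {R}.

(** * Size of the Newton interpolant of a small function *)

Section Bound.
Variable R : realType.
Local Notation K := (Cx R).
Implicit Types (D : set K) (J : nat -> K -> K) (s : seq K).

Definition jet_on D N J :=
  forall j z, (j < N)%N -> D z -> wderiv D (J j) (J j.+1 z) z.

(** [cl] labels the components of D: distinct components are at distance at least
    d, and each of them is convex. *)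
Definition clustered (T : eqType) (cl : K -> T) D (M d : K) :=
  [/\ forall z, D z -> `|z| <= M,
      forall z w, D z -> D w -> cl z != cl w -> d <= `|z - w| &
      forall z w t, D z -> D w -> cl z = cl w -> unit_seg t ->
        D (z + t * (w - z)) /\ cl (z + t * (w - z)) = cl z].

(** [newton] is linear in the jet, so it commutes with differentiation with respect
    to a parameter of the jet. *)
Lemma wderiv_newton D (t : K) s (J : K -> nat -> K -> K) dJ :
  (forall j a, (j < size s)%N -> a \in s ->
    wderiv D (fun u => J u j a) (dJ j a) t) ->
  forall k, wderiv D (fun u => (newton s (J u))`_k) (newton s dJ)`_k t.
Proof.
elim: s J dJ => [|mu s IH] J dJ dJP k /=.
  by under eq_fun do rewrite coef0; rewrite coef0; exact: wderiv_cst.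
have mus : mu \in mu :: s by rewrite mem_head.
have {}IH k' : wderiv D (fun u => (newton s (ddiff mu (J u)))`_k')
    (newton s (ddiff mu dJ))`_k' t.
  apply: IH => j a js ins; rewrite /ddiff; case: eqP => _.
    rewrite mulrC; under eq_fun do rewrite mulrC.
    exact/wderiv_scale/dJP.
  have {}ins : a \in mu :: s by rewrite inE ins orbT.
  elim: j js => [|j IHj] js /=; rewrite mulrC; under eq_fun do rewrite mulrC.
    apply: wderiv_scale; apply: wderiv_add; first exact: dJP.
    rewrite -mulN1r; under eq_fun do rewrite -mulN1r.
    exact/wderiv_scale/dJP.
  apply: wderiv_scale; apply: wderiv_add; first by apply: dJP => //; apply: ltnW.
  rewrite -mulNr; under eq_fun do rewrite -mulNr.
  by apply/wderiv_scale/IHj/ltnW.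
have cE (c : K) (r : {poly K}) : (c%:P + ('X - mu%:P) * r)`_k =
    (k == 0%N)%:R * c + ((k != 0%N)%:R * r`_k.-1 + (- mu) * r`_k).
  rewrite coefD coefC mulrBl coefB coefXM coefCM mulNr.
  by case: eqP => _; rewrite ?mul1r ?mul0r ?add0r.
rewrite cE; under eq_fun do rewrite cE.
apply: wderiv_add; first exact/wderiv_scale/dJP.
by apply: wderiv_add; apply: wderiv_scale.
Qed.

Lemma coef_XsubCM_le (mu M b : K) (r : {poly K}) : `|mu| <= M ->
  (forall k, `|r`_k| <= b) -> forall k, `|(('X - mu%:P) * r)`_k| <= (1 + M) * b.
Proof.
move=> muM rb k; rewrite mulrBl coefB coefXM coefCM mulrDl mul1r.
apply: le_trans (ler_normB _ _) _; apply: lerD.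
  by case: eqP => _ //; rewrite normr0 (le_trans _ (rb 0%N)).
by rewrite normrM ler_pM.
Qed.

(** The growth of the derivatives of a quotient by z - mu on |z - mu| >= d, read
    off from the recursion of [ddiff_off]. *)
Fixpoint off_const (d : K) j : K :=
  if j is i.+1 then (1 + j%:R * off_const d i) / d else 2%:R / d.

Lemma off_const_ge0 d j : 0 < d -> 0 <= off_const d j.
Proof.
move=> d0; elim: j => [|j IH] /=; apply: divr_ge0; rewrite ?ler0n ?(ltW d0) //.
by rewrite addr_ge0 ?mulr_ge0 ?ler0n.
Qed.

Lemma ddiff_off_le (mu a d e : K) J N : 0 < d -> d <= `|a - mu| ->
  `|J 0%N mu| <= e -> (forall j, (j < N)%N -> `|J j a| <= e) ->
  forall j, (j < N)%N -> `|ddiff_off mu J a j| <= off_const d j * e.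
Proof.
move=> d0 da Jmu Ja j jN.
have e0 : 0 <= e by apply: le_trans Jmu.
have div x y : `|x| <= y -> `|x / (a - mu)| <= y / d.
  move=> xy; rewrite normrM normfV ler_pM ?invr_ge0 //.
  by rewrite lef_pV2 // posrE (lt_le_trans d0).
elim: j jN => [|j IH] jN /=; rewrite mulrAC; apply: div.
  by rewrite mulr_natl mulr2n (le_trans (ler_normB _ _)) // lerD // Ja.
rewrite (le_trans (ler_normB _ _)) // mulrDl mul1r lerD ?Ja //.
by rewrite normrM normr_nat -mulrA ler_wpM2l ?ler0n ?IH // ltnW.
Qed.

Lemma jet_on_ddiff_off D mu J N : (forall w, D w -> w != mu) ->
  jet_on D N J ->
  jet_on D N (fun j w => ddiff_off mu J w j).
Proof.
move=> Dmu dJ j z jN Dz.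
have zm w : D w -> w - mu != 0 by move=> /Dmu; rewrite subr_eq0.
have dinv : wderiv D (fun w => (w - mu)^-1) (- (z - mu) ^- 2) z.
  have dB : wderiv D (fun w => w - mu) 1 z.
    by have := wderiv_add (wderiv_id D z) (wderiv_cst D (- mu) z); rewrite addr0.
  by have := wderiv_inv dB (zm z Dz) zm; rewrite mulN1r.
have z0 := zm z Dz.
elim: j jN => [|j IH] jN.
  have dJ0 := wderiv_add (dJ 0%N z jN Dz) (wderiv_cst D (- J 0%N mu) z).
  have := wderiv_mul dJ0 dinv; congr (wderiv _ _ _ _) => /=.
  by field.
have dh := wderiv_scale (- j.+1%:R) (IH (ltnW jN)).
have := wderiv_mul (wderiv_add (dJ j.+1 z jN Dz) dh) dinv.
under eq_fun do rewrite mulNr.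
congr (wderiv _ _ _ _) => /=.
set h := ddiff_off _ _ _ _.
by rewrite -[j.+2%:R]natr1; field.
Qed.

Section Step.
Variables (T : eqType) (cl : K -> T) (D : set K) (M d : K).
Hypotheses (d0 : 0 < d) (Dcl : clustered cl D M d).
Variables (mu : K) (J : nat -> K -> K).
Hypothesis Dmu : D mu.

(** The jet of z |-> g(mu + t(z - mu)) on the component of mu, and of g itself on
    the other components, where the segment from mu to z may leave D. *)
Definition path_jet (t : K) j a :=
  if cl a == cl mu then t ^+ j * J j (mu + t * (a - mu)) else J j a.

(** The jet of z |-> g'(mu + t(z - mu)) on the component of mu, and 0 elsewhere:
    the t-derivative of [path_jet] is z - mu times this jet. *)
Definition path_speed (t : K) j a :=
  if cl a == cl mu then t ^+ j * J j.+1 (mu + t * (a - mu)) else 0.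

(** The divided difference at mu of the function reached at t = 0, which is
    constant on the component of mu. *)
Definition off_jet j a := if cl a == cl mu then 0 else ddiff_off mu J a j.

Lemma path_jet1 : path_jet 1 = J.
Proof.
apply/funext => j; apply/funext => a; rewrite /path_jet.
by rewrite expr1n !mul1r addrC subrK; case: ifP.
Qed.

Lemma ddiff_path_jet0 : ddiff mu (path_jet 0) = off_jet.
Proof.
apply/funext => j; apply/funext => a; rewrite /ddiff /off_jet.
case: eqVneq => [->|amu].
  by rewrite eqxx /path_jet eqxx expr0n /= !mul0r.
case: eqVneq => acl.
  elim: j => [|j IH] /=; rewrite /path_jet ?acl eqxx.
    by rewrite !mul0r subrr mul0r.
  by rewrite IH expr0n /= mul0r mulr0 subrr mul0r.
elim: j => [|j IH] /=; rewrite ?IH /path_jet ?eqxx (negPf acl) //.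
by rewrite expr0 mul1r mul0r addr0.
Qed.

Lemma near_cl z : D z -> \forall w \near z, D w -> cl w = cl z.
Proof.
case: Dcl => _ sep _ Dz; apply/nbhs_ballP; exists d => //= w.
rewrite -ball_normE /= => zw Dw; apply/eqP; apply: contraLR zw => zw.
have := sep z w Dz Dw; rewrite eq_sym zw => /(_ isT) dzw.
by rewrite le_gtF.
Qed.

Lemma path_sub t a : D a -> cl a = cl mu -> unit_seg t ->
  D (mu + t * (a - mu)).
Proof. by case: Dcl => _ _ cv Da ac tI; have [] := cv mu a t Dmu Da (esym ac) tI. Qed.

Lemma wderiv_path_jet N t j a : jet_on D N J -> unit_seg t -> D a -> (j < N)%N ->
  wderiv unit_seg (fun u => path_jet u j a) (jetM mu (path_speed t) j a) t.
Proof.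
move=> dJ tI Da jN; rewrite /path_jet /jetM /path_speed.
case: eqVneq => ac; last first.
  by rewrite !mulr0 addr0; apply: wderiv_cst.
have dlin : wderiv unit_seg (fun u => mu + u * (a - mu)) (a - mu) t.
  have dt := wderiv_scale (a - mu) (wderiv_id unit_seg t).
  have := wderiv_add (wderiv_cst unit_seg mu t) dt.
  by rewrite add0r mulr1; under eq_fun do rewrite mulrC.
have pin u : unit_seg u -> D (mu + u * (a - mu)) by apply: path_sub.
have dJt := wderiv_comp pin (dJ j _ jN (pin t tI)) dlin.
have := wderiv_mul (wderiv_exp unit_seg t j) dJt.
congr (wderiv _ _ _ _); rewrite /=.
by case: j jN {dJt} => [|j] jN /=; rewrite ?mul0r; ring.
Qed.

Lemma jet_on_path_speed N t : jet_on D N.+1 J -> unit_seg t ->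
  jet_on D N (path_speed t).
Proof.
move=> dJ tI j z jN Dz.
apply: (@wderiv_local _ _ [set w | cl w = cl z]
   (if cl z == cl mu then fun w => t ^+ j * J j.+1 (mu + t * (w - mu))
    else fun _ => 0)) => //.
- exact: near_cl.
- by move=> w _ /=; rewrite /path_speed => ->; case: ifP.
rewrite /path_speed; case: eqVneq => zc; last exact: wderiv_cst.
have dlin D' : wderiv D' (fun w => mu + t * (w - mu)) t z.
  have dB := wderiv_add (wderiv_id D' z) (wderiv_cst D' (- mu) z).
  have := wderiv_add (wderiv_cst D' mu z) (wderiv_scale t dB).
  by rewrite add0r addr0 mulr1.
have pin w : (D `&` [set w | cl w = cl z]) w -> D (mu + t * (w - mu)).
  by move=> [Dw /= wc]; apply: path_sub => //; rewrite wc.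
have dJz := dJ j.+1 _ jN (pin z (conj Dz erefl)).
have := wderiv_scale (t ^+ j) (wderiv_comp pin dJz (dlin _)).
by congr (wderiv _ _ _ _); rewrite exprSr; ring.
Qed.

Lemma jet_on_off_jet N : jet_on D N J -> jet_on D N off_jet.
Proof.
move=> dJ j z jN Dz; rewrite /off_jet.
apply: (@wderiv_local _ _ [set w | cl w = cl z]
   (if cl z == cl mu then fun _ => 0 else fun w => ddiff_off mu J w j)) => //.
- exact: near_cl.
- by move=> w _ /= ->; case: ifP.
case: eqVneq => zc; first exact: wderiv_cst.
apply: (@jet_on_ddiff_off _ _ _ N) => //.
  by move=> w [_ /= wc]; apply/eqP => wmu; move: zc; rewrite -wc wmu eqxx.
by move=> i w iN [Dw _]; apply: wderiv_sub (dJ i w iN Dw) => ? [].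
Qed.

End Step.

(** The constant depends on neither the nodes nor the set, so that it survives the
    collision of nodes and the shrinking of the discs.  Induction on the number of
    nodes: along the path the interpolant moves with speed X - mu times the
    interpolant of [path_speed] on the remaining nodes, and its end point at
    t = 0 is g(mu) plus X - mu times the interpolant of [off_jet]; the induction
    hypothesis bounds both. *)
Lemma newton_coef_le m (M d : K) : 0 <= M -> 0 < d -> exists2 c : K, 0 <= c &
  forall (T : eqType) (cl : K -> T) D s J (e : K), clustered cl D M d ->
  size s = m -> (forall a, a \in s -> D a) -> jet_on D m J ->
  (forall j z, (j < m)%N -> D z -> `|J j z| <= e) ->
  forall k, `|(newton s J)`_k| <= c * e.
Proof.
move=> M0 d0; elim: m => [|m [c c0 IH]].
  exists 0 => // T cl D [|//] J e _ _ _ _ _ k.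
  by rewrite coef0 normr0 mul0r.
pose B := \sum_(i < m) off_const d i.
have B0 : 0 <= B by apply: sumr_ge0 => i _; apply: off_const_ge0.
exists (1 + (1 + M) * (c * B) + (1 + M) * c).
  by rewrite !addr_ge0 ?mulr_ge0 ?addr_ge0.
move=> T cl D [//|mu s] J e Dcl [sm] sD dJ Je k.
have Dmu : D mu by apply: sD; rewrite mem_head.
have Ds a : a \in s -> D a by move=> ins; apply: sD; rewrite inE ins orbT.
have e0 : 0 <= e by apply: le_trans (Je 0%N mu isT Dmu).
have [DM Dsep Dconv] := Dcl.
pose phi t := (newton (mu :: s) (path_jet cl mu J t))`_k.
pose dphi t := (newton (mu :: s) (jetM mu (path_speed cl mu J t)))`_k.
have dphiP t : unit_seg t -> wderiv unit_seg phi (dphi t) t.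
  move=> tI; apply: wderiv_newton => j a js ins.
  apply: (wderiv_path_jet Dcl Dmu dJ) => //; first exact: sD.
  by rewrite -sm.
have dphi_le t : unit_seg t -> `|dphi t| <= (1 + M) * c * e.
  move=> tI; rewrite /dphi /= ddiff_jetM /jetM subrr !mul0r add0r add0r.
  rewrite -mulrA; apply: coef_XsubCM_le => [|k']; first exact: DM.
  apply: (IH _ _ _ _ _ _ Dcl) => //.
    exact: (jet_on_path_speed d0 Dcl Dmu dJ tI).
  move=> j z jm Dz; rewrite /path_speed; case: eqVneq => zc; last by rewrite normr0.
  have /andP[t0 t1] := tI.
  rewrite normrM normrX (ger0_norm t0) -[leRHS]mul1r ler_pM ?exprn_ge0 //.
    exact: exprn_ile1.
  by apply: Je => //; apply: (path_sub Dcl).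
have := mean_value_le dphiP dphi_le.
rewrite {1}/phi path_jet1 => le1.
rewrite -[newton _ _]/(newton (mu :: s) J) -(subrK (phi 0) (newton _ _)`_k).
rewrite addrC mulrDl (le_trans (ler_normD _ _)) // lerD //.
rewrite /phi /= ddiff_path_jet0 coefD [leRHS]mulrDl mul1r.
rewrite (le_trans (ler_normD _ _)) // lerD //.
  rewrite coefC; case: eqP => _; last by rewrite normr0.
  by rewrite /path_jet eqxx expr0 mul1r mul0r addr0 Je.
rewrite -mulrA; apply: coef_XsubCM_le => [|k']; first exact: DM.
rewrite -mulrA; apply: (IH _ _ _ _ _ _ Dcl) => //.
  by apply: (jet_on_off_jet d0 Dcl) => j z jm; apply: dJ; apply: ltnW.
move=> j z jm Dz; rewrite /off_jet; case: eqVneq => zc.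
  by rewrite normr0 mulr_ge0.
have : off_const d j <= B.
  rewrite /B (bigD1 (Ordinal jm)) //= lerDl.
  by apply: sumr_ge0 => i _; apply: off_const_ge0.
move=> le_B; apply: le_trans (ler_wpM2r e0 le_B).
apply: (@ddiff_off_le _ _ _ _ _ m) => //.
- exact: Dsep.
- exact: Je.
- by move=> i im; apply: Je => //; apply: ltnW.
Qed.

End Bound.

(** * Norm estimates for matrices and their eigenvalues *)

Section MxNorm.
Variable K : numFieldType.

Lemma mx_norm_entry m n (M : 'M[K]_(m, n)) i j : `|M i j| <= `|M|.
Proof.
have num_bigmax (I : finType) (F : I -> {nonneg K}) k :
    (F k)%:num <= (\big[Num.max/0%:nng]_l F l)%:num.
  by rewrite num_le; apply: le_bigmax.
rewrite [leRHS]/Num.Def.normr /= mx_normE.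
exact: (num_bigmax _ (fun k : 'I_m * 'I_n => `|M k.1 k.2|%:nng) (i, j)).
Qed.

Lemma mx_norm_le m n (M : 'M[K]_(m, n)) (b : K) : 0 <= b ->
  (forall i j, `|M i j| <= b) -> `|M| <= b.
Proof.
move=> /nonnegP[{}b] Mb; rewrite [leLHS]/Num.Def.normr /= mx_normE num_le.
by apply/bigmax_leP; split=> [|[i j] _]; rewrite -num_le //=.
Qed.

Lemma mx_normM m n p (A : 'M[K]_(m, n)) (B : 'M[K]_(n, p)) :
  `|A *m B| <= n%:R * `|A| * `|B|.
Proof.
apply: mx_norm_le => [|i j]; first by rewrite !mulr_ge0 ?ler0n.
rewrite mxE (le_trans (ler_norm_sum _ _ _)) // -mulrA mulr_natl.
have -> : `|A| * `|B| *+ n = \sum_(k < n) `|A| * `|B|.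
  by rewrite sumr_const card_ord.
by apply: ler_sum => k _; rewrite normrM ler_pM ?mx_norm_entry.
Qed.

Lemma det_le n (A : 'M[K]_n) (b : K) : (forall i j, `|A i j| <= b) ->
  `|\det A| <= n`!%:R * b ^+ n.
Proof.
move=> Ab; rewrite (le_trans (ler_norm_sum _ _ _)) // mulr_natl.
have -> : b ^+ n *+ n`! = \sum_(s : {perm 'I_n}) b ^+ n.
  by rewrite sumr_const card_Sn.
apply: ler_sum => s _.
rewrite normrM normrX normrN1 expr1n mul1r normr_prod.
have -> : b ^+ n = \prod_(i < n) b by rewrite prodr_const card_ord.
by apply: ler_prod => i _; rewrite normr_ge0 Ab.
Qed.

Lemma adj_le n (A : 'M[K]_n) (b : K) : 1 <= b -> (forall i j, `|A i j| <= b) ->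
  `|\adj A| <= n`!%:R * b ^+ n.
Proof.
move=> b1 Ab; have b0 : 0 <= b by apply: le_trans b1.
apply: mx_norm_le => [|i j]; first by rewrite mulr_ge0 ?exprn_ge0 ?ler0n.
rewrite mxE /cofactor normrM normrX normrN1 expr1n mul1r.
apply: le_trans (det_le (b := b) _) _; first by move=> k l; rewrite !mxE.
apply: ler_pM; rewrite ?ler0n ?exprn_ge0 //; last by rewrite ler_weXn2l ?leq_pred.
by rewrite ler_nat leq_fact ?leq_pred.
Qed.

End MxNorm.

Section MxHornerNorm.
Variable K : numClosedFieldType.

Lemma mx_horner_widen n m (p : {poly K}) (M : 'M[K]_n) : (size p <= m)%N ->
  mx_horner p M = \sum_(i < m) p`_i *: M ^+ i.
Proof.
move=> pm; rewrite /mx_horner (big_ord_widen _ (fun i => p`_i *: M ^+ i) pm).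
rewrite [RHS](bigID (fun i : 'I_m => (i < size p)%N)) /=.
rewrite [X in _ = _ + X]big1 ?addr0 // => i; rewrite -leqNgt => si.
by rewrite nth_default // scale0r.
Qed.

Lemma mx_hornerD n (p q : {poly K}) (M : 'M[K]_n) :
  mx_horner (p + q) M = mx_horner p M + mx_horner q M.
Proof.
rewrite !(@mx_horner_widen _ (maxn (size p) (size q))) ?size_polyD //.
- rewrite -big_split; apply: eq_bigr => i _.
  by rewrite coefD scalerDl.
- exact: leq_maxr.
- exact: leq_maxl.
Qed.

Lemma mx_normX n (M : 'M[K]_n) (B : K) i : n%:R * `|M| <= B -> `|M ^+ i| <= B ^+ i.
Proof.
move=> MB; have B0 : 0 <= B by apply: le_trans MB; rewrite mulr_ge0 ?ler0n.
elim: i => [|i IH].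
  rewrite !expr0; apply: mx_norm_le => // i j.
  by rewrite -[1]/(1%:M) mxE; case: eqP => _; rewrite ?normr1 ?normr0 ?ler01.
rewrite !exprSr; apply: le_trans (mx_normM _ _) _.
by rewrite [n%:R * _]mulrC -mulrA ler_pM ?mulr_ge0 ?ler0n.
Qed.

Lemma mx_horner_le n m (p : {poly K}) (M : 'M[K]_n) (B b : K) : (size p <= m)%N ->
  n%:R * `|M| <= B -> (forall k, `|p`_k| <= b) ->
  `|mx_horner p M| <= (\sum_(i < m) B ^+ i) * b.
Proof.
move=> pm MB pb; rewrite (mx_horner_widen _ pm) (le_trans (ler_norm_sum _ _ _)) //.
rewrite mulr_suml; apply: ler_sum => i _.
by rewrite normrZ mulrC ler_pM // mx_normX.
Qed.

Lemma det_eigseq n (M : 'M[K]_n) (mu : K) :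
  \det (mu%:M - M) = \prod_(a <- eigseq M) (mu - a).
Proof.
have -> : \prod_(a <- eigseq M) (mu - a) = (char_poly M).[mu].
  rewrite eigseqE horner_prod; apply: eq_bigr => a _.
  by rewrite hornerXsubC.
rewrite /char_poly -[RHS]/(horner_eval mu _) -det_map_mx; congr (\det _).
apply/matrixP => i j; rewrite !mxE /= /horner_eval hornerD hornerN hornerC.
by rewrite hornerMn hornerX.
Qed.

(** If v is a left eigenvector of X + E for mu, then v(mu - X) = vE; multiplying by
    the adjugate of mu - X gives det(mu - X) v = v E adj(mu - X), where
    det(mu - X) is the product of the differences mu - a. *)
Lemma eigenvalue_perturb n (X : 'M[K]_n) : exists2 C : K, 0 < C &
  forall (E : 'M[K]_n) mu, `|E| <= 1 -> mu \in eigseq (X + E) ->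
    \prod_(a <- eigseq X) `|mu - a| <= C * `|E|.
Proof.
(* b bounds the entries of mu - X, since |mu| <= n |X + E|. *)
pose b : K := n%:R * (`|X| + 1) + `|X| + 1.
have X1 : 0 <= `|X| + 1 :> K by rewrite addr_ge0.
have b1 : 1 <= b by rewrite lerDr addr_ge0 ?mulr_ge0 ?ler0n.
pose B : K := n`!%:R * b ^+ n.
have B0 : 0 <= B by rewrite mulr_ge0 ?ler0n ?exprn_ge0 // (le_trans _ b1).
exists (1 + n%:R * n%:R * B).
  by apply: ltr_wpDr; rewrite ?ltr01 ?(mulr_ge0 _ B0) ?mulr_ge0 ?ler0n.
move=> E mu E1; rewrite mem_eigseq => /eigenvalueP[v vY v0].
have v_gt0 : 0 < `|v| by rewrite normr_gt0.
have muY : `|mu| <= n%:R * (`|X| + 1).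
  rewrite -(ler_pM2r v_gt0) -normrZ -vY (le_trans (mx_normM _ _)) //.
  rewrite -!mulrA ler_wpM2l ?ler0n // mulrC ler_wpM2r //.
  by rewrite (le_trans (ler_normD _ _)) // lerD2l.
rewrite -normr_prod -det_eigseq.
have vE : v *m (mu%:M - X) = v *m E.
  by rewrite mulmxBr mul_mx_scalar -vY -mulmxBr addrC addKr.
have vdet : \det (mu%:M - X) *: v = v *m E *m \adj (mu%:M - X).
  by rewrite -vE -mulmxA mul_mx_adj mul_mx_scalar.
have adjB : `|\adj (mu%:M - X)| <= B.
  apply: adj_le => // i j; rewrite !mxE (le_trans (ler_normB _ _)) //.
  rewrite /b -addrA lerD //.
    by case: eqP => _ //; rewrite normr0 mulr_ge0 ?ler0n.
  by rewrite (le_trans (mx_norm_entry _ _ _)) // lerDl.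
rewrite -(ler_pM2r v_gt0) -normrZ vdet (le_trans (mx_normM _ _)) //.
apply: (@le_trans _ _ (n%:R * (n%:R * `|v| * `|E|) * B)).
  by rewrite ler_pM ?mulr_ge0 ?ler0n // ler_wpM2l ?ler0n ?mx_normM.
have -> : n%:R * (n%:R * `|v| * `|E|) * B = n%:R * n%:R * B * `|E| * `|v| by ring.
by rewrite !ler_wpM2r // lerDr.
Qed.

Lemma exists_le_of_prod_le (s : seq K) (mu rho : K) : 0 <= rho -> (0 < size s)%N ->
  \prod_(a <- s) `|mu - a| <= rho ^+ size s ->
  exists2 a, a \in s & `|mu - a| <= rho.
Proof.
move=> r0 s0 le_s; case: (boolP (has (fun a => `|mu - a| <= rho) s)).
  by move=> /hasP[a as_ ale]; exists a.
move=> /hasPn far; exfalso.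
have {}far a : a \in s -> rho < `|mu - a|.
  by move=> /far; rewrite -real_ltNge ?normr_real ?ger0_real.
suff : rho ^+ size s < \prod_(a <- s) `|mu - a| by rewrite le_gtF.
case: s s0 far {le_s} => // a s _.
elim: s a => [|b s IH] a far; first by rewrite big_seq1 far ?mem_head.
rewrite big_cons exprS; apply: ltr_pM; rewrite ?exprn_ge0 ?far ?mem_head //.
by apply: IH => c cs; apply: far; rewrite inE cs orbT.
Qed.

End MxHornerNorm.

(** * Functions vanishing to high order at the spectrum *)

Section Flat.
Variable R : realType.
Local Notation K := (Cx R).
Implicit Types (J : nat -> K -> K) (U : set K).

(** Descending induction on j: the mean value inequality along the segment from lam
    to z gains one factor |z - lam| for each derivative. *)
Lemma flat_jet U J L (lam eta : K) : open U -> U lam -> jet_on U L J ->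
  {for lam, continuous (J L)} -> (forall j, (j <= L)%N -> J j lam = 0) ->
  0 < eta ->
  exists2 r : K, 0 < r & forall z, `|z - lam| <= r ->
    U z /\ forall j, (j <= L)%N -> `|J j z| <= eta * `|z - lam| ^+ (L - j).
Proof.
move=> oU Ulam dJ cJ J0 eta0.
have [r r0 rH] : exists2 r : K, 0 < r &
    forall z, `|z - lam| <= r -> U z /\ `|J L z| <= eta.
  have /nbhs_ballP[d /= d0 dH] : \forall z \near lam, U z /\ `|J L z| <= eta.
    near=> z; split.
      by near: z; apply: open_nbhs_nbhs.
    rewrite -[J L z]subr0 -(J0 L (leqnn _)) distrC; apply: ltW.
    by near: z; move/cvgrPdist_lt: cJ; apply.
  exists (d / 2) => [|z zr]; first by rewrite divr_gt0 ?ltr0n.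
  apply: dH; rewrite -ball_normE /= distrC (le_lt_trans zr) //.
  by rewrite ltr_pdivrMr ?ltr0n // ltr_pMr // ltr1n.
exists r => // z zr; split=> [|j jL]; first by have [] := rH z zr.
have [k kE] : exists k, (L - j)%N = k by eexists.
elim: k j jL kE z zr => [|k IH] j jL kE z zr.
  have -> : j = L by apply/eqP; rewrite eqn_leq jL -subn_eq0 kE.
  by rewrite subnn expr0 mulr1; have [] := rH z zr.
have jlt : (j < L)%N by rewrite -subn_gt0 kE.
have kE' : (L - j.+1)%N = k by rewrite subnS kE.
have seg t : unit_seg t -> `|lam + t * (z - lam) - lam| <= `|z - lam|.
  move=> /andP[t0 t1]; rewrite addrC addKr normrM (ger0_norm t0).
  by rewrite ler_piMl.
have lin t : wderiv unit_seg (fun t => lam + t * (z - lam)) (z - lam) t.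
  have dt := wderiv_scale (z - lam) (wderiv_id unit_seg t).
  have := wderiv_add (wderiv_cst unit_seg lam t) dt.
  by rewrite add0r mulr1; under eq_fun do rewrite mulrC.
have inU t : unit_seg t -> U (lam + t * (z - lam)).
  by move=> tI; have [] := rH (lam + t * (z - lam)) (le_trans (seg t tI) zr).
have e1 : lam + 1 * (z - lam) = z by rewrite mul1r addrC subrK.
have e0 : lam + 0 * (z - lam) = lam by rewrite mul0r addr0.
have := @mean_value_le _ (fun t => J j (lam + t * (z - lam)))
  (fun t => J j.+1 (lam + t * (z - lam)) * (z - lam)) (eta * `|z - lam| ^+ (L - j)).
rewrite e1 e0 (J0 j jL) subr0; apply.
  move=> t tI; exact: (wderiv_comp inU (dJ j _ jlt (inU t tI)) (lin t)).
move=> t tI; rewrite normrM kE exprSr mulrA ler_wpM2r //.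
apply: le_trans (IH j.+1 jlt kE' _ (le_trans (seg t tI) zr)) _.
rewrite kE' ler_wpM2l ?(ltW eta0) // lerXn2r ?nnegrE ?normr_ge0 //.
exact: seg.
Unshelve. all: by end_near.
Qed.

Lemma flat_jet_seq U J L (s : seq K) (eta : K) : open U ->
  (forall a, a \in s -> U a) -> jet_on U L J ->
  (forall a, a \in s -> {for a, continuous (J L)}) ->
  (forall a j, a \in s -> (j <= L)%N -> J j a = 0) ->
  0 < eta ->
  exists2 r : K, 0 < r & forall a z, a \in s -> `|z - a| <= r ->
    U z /\ forall j, (j <= L)%N -> `|J j z| <= eta * `|z - a| ^+ (L - j).
Proof.
move=> oU + dJ + + eta0; elim: s => [|b s IH] sU sc s0.
  by exists 1.
have [|||r r0 rH] := IH.
- by move=> a ins; apply: sU; rewrite inE ins orbT.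
- by move=> a ins; apply: sc; rewrite inE ins orbT.
- by move=> a j ins; apply: s0; rewrite inE ins orbT.
have bs : b \in b :: s by rewrite mem_head.
have [r' r'0 r'H] := flat_jet oU (sU b bs) dJ (sc b bs) (fun j => @s0 b j bs) eta0.
have rr : r >=< r' by apply: real_comparable; apply: gtr0_real.
exists (Num.min r r'); first by rewrite comparable_lt_min // r0.
move=> a z; rewrite comparable_le_min // inE => /orP[/eqP->|ins] /andP[z1 z2].
  exact: r'H.
exact: rH.
Qed.

Lemma separation (s : seq K) : exists2 d : K, 0 < d &
  forall a b, a \in s -> b \in s -> a != b -> d <= `|a - b|.
Proof.
suff [d d0 dH] : exists2 d : K, 0 < d &
    forall p, p \in [seq (a, b) | a <- s, b <- s] -> p.1 != p.2 -> d <= `|p.1 - p.2|.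
  exists d => // a b as_ bs ab; apply: (dH (a, b)) => //.
  by apply/allpairsP; exists (a, b).
elim: [seq _ | _ <- _, _ <- _] => [|p t [d d0 dH]]; first by exists 1.
pose e := if p.1 == p.2 then 1 else `|p.1 - p.2|.
have e0 : 0 < e.
  by rewrite /e; case: eqVneq => // np; rewrite normr_gt0 subr_eq0.
have de : d >=< e by apply: real_comparable; apply: gtr0_real.
exists (Num.min d e); first by rewrite comparable_lt_min // d0.
move=> q; rewrite inE comparable_ge_min // => /orP[/eqP->|qt] npq.
  by rewrite /e (negPf npq) lexx orbT.
by rewrite dH.
Qed.

End Flat.

(** * Matrix functions are approximated to first order by polynomials *)

Section Main.
Variable R : realType.
Local Notation K := (Cx R).

Section Balls.
Variables (s : seq K) (rho : K).

Definition balls : set K := [set z | exists2 a, a \in s & `|z - a| <= rho].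
(** Some centre whose disc contains z; the default 0 is reached only outside
    [balls]. *)
Definition center (z : K) : K := nth 0 s (find (fun a => `|z - a| <= rho) s).

Lemma centerP z : balls z -> center z \in s /\ `|z - center z| <= rho.
Proof.
move=> [a ins az].
have hs : has (fun a => `|z - a| <= rho) s by apply/hasP; exists a.
by split; [rewrite mem_nth // -has_find|exact: (nth_find 0 hs)].
Qed.

Lemma clustered_balls (d M : K) : 0 <= rho -> 0 < d -> rho *+ 4 <= d ->
  (forall a b, a \in s -> b \in s -> a != b -> d <= `|a - b|) ->
  (forall a, a \in s -> `|a| + rho <= M) ->
  clustered center balls M (d / 2).
Proof.
move=> r0 d0 rd sep sb.
have rd2 : rho + rho <= d / 2.
  by rewrite ler_pdivlMr ?ltr0n // mulr_natr mulrnDl -mulrnDr.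
have rd1 : rho + rho < d.
  by apply: le_lt_trans rd2 _; rewrite ltr_pdivrMr ?ltr0n // ltr_pMr // ltr1n.
split.
- move=> z /centerP[zs zr]; apply: le_trans (sb _ zs).
  by rewrite -lerBlDl (le_trans (lerB_dist _ _)).
- move=> z w /centerP[zs zr] /centerP[ws wr] zw.
  rewrite -(lerD2r (d / 2)) -splitr addrC.
  apply: le_trans (sep _ _ zs ws zw) _.
  have -> : center z - center w = (z - w) + ((w - center w) - (z - center z)) by ring.
  rewrite (le_trans (ler_normD _ _)) // [leRHS]addrC lerD2l.
  by rewrite (le_trans (ler_normB _ _)) // (le_trans _ rd2) // lerD.
- move=> z w t /[dup] Dz /centerP[zs zr] /centerP[ws wr] zw /andP[t0 t1].
  set u := z + t * (w - z).
  have uz : `|u - center z| <= rho.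
    have -> : u - center z = (1 - t) * (z - center z) + t * (w - center w).
      by rewrite -zw /u; ring.
    rewrite (le_trans (ler_normD _ _)) // !normrM (ger0_norm t0) ger0_norm ?subr_ge0 //.
    have -> : rho = (1 - t) * rho + t * rho by ring.
    by rewrite lerD // ler_wpM2l // subr_ge0.
  have Du : balls u by exists (center z).
  split=> //; have [us ur] := centerP Du.
  apply/eqP; apply: contraT => cuz; have := sep _ _ us zs cuz.
  rewrite lt_geF // (le_lt_trans _ rd1) //.
  have -> : center u - center z = (u - center z) - (u - center u) by ring.
  by rewrite (le_trans (ler_normB _ _)) // lerD.
Qed.

End Balls.

Lemma count_flatten_nseq (T : eqType) (a : T) m (s : seq T) :
  count_mem a (flatten (nseq m s)) = (m * count_mem a s)%N.
Proof. by rewrite count_flatten map_nseq sumn_nseq mulnC. Qed.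

(** Repeating the whole spectrum 2n times prescribes at least 2n derivatives at
    every eigenvalue. *)
Definition osculating_poly n (f : K -> K) (X : 'M[K]_n) : {poly K} :=
  newton (flatten (nseq (2 * n) (eigseq X))) (jets f).

Lemma osculating_polyP n f (X : 'M[K]_n) a j : a \in eigseq X -> (j < 2 * n)%N ->
  (derivn j (osculating_poly f X)).[a] = derive1n j f a.
Proof.
move=> aX jn; apply: newtonP; rewrite count_flatten_nseq.
by apply: (leq_trans jn); rewrite leq_pmulr // -has_count has_pred1.
Qed.

Lemma mxfun_osculating n f (X : 'M[K]_n) :
  mxfun f X = mx_horner (osculating_poly f X) X.
Proof.
apply: (@mxfunE _ _ _ _ (eigseq X)); first by rewrite -eigseqE mx_horner_char_poly.
move=> a j ja; apply: osculating_polyP.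
  by rewrite -has_pred1 has_count (leq_ltn_trans _ ja).
apply: (leq_trans ja); rewrite (leq_trans (count_size _ _)) // size_eigseq.
by rewrite mul2n -addnn leq_addr.
Qed.

Definition remainder_jet n f (X : 'M[K]_n) j z :=
  derive1n j f z - (derivn j (osculating_poly f X)).[z].

Lemma jet_on_remainder N U n f (X : 'M[K]_n) : cont_diff_on N U f ->
  jet_on U N (remainder_jet f X).
Proof.
move=> [oU dU _] j z jN Uz.
have df := wderiv_sub (@subsetT _ U) (wderiv_derivable (dU j z jN Uz)).
have dp := wderiv_scale (-1) (wderiv_horner U z (derivn j (osculating_poly f X))).
have := wderiv_add df dp; rewrite mulN1r -derivnS.
by congr (wderiv _ _ _ _); apply/funext => w; rewrite mulN1r.
Qed.

Lemma remainder_jet_continuous N U n f (X : 'M[K]_n) j z :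
  cont_diff_on N U f -> (j <= N)%N -> U z ->
  {for z, continuous (remainder_jet f X j)}.
Proof.
move=> [_ _ cU] jN Uz; apply: continuousB; first exact: cU.
have := wderiv_cvg (wderiv_horner setT z (derivn j (osculating_poly f X))).
by rewrite withinET.
Qed.

(** With L = 2n - 1, a derivative of order j < n of the remainder at distance at
    most rho from the spectrum is at most a small constant times rho^(L - j), and
    L - j >= n. *)
Lemma mxfun_osculating_littleo N U n f (X : 'M[K]_n) :
  (0 < n)%N -> (2 * n - 1 <= N)%N ->
  cont_diff_on N U f -> spec X `<=` U ->
  forall eta : K, 0 < eta -> exists2 del : K, 0 < del & forall E, `|E| < del ->
    `|mxfun f (X + E) - mx_horner (osculating_poly f X) (X + E)| <= eta * `|E|.
Proof.
move=> n0 nN fU XU eta eta0.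
have oU : open U by case: fU.
have L0 : (n <= (2 * n).-1)%N.
  by rewrite mul2n -addnn -(prednK n0) addSn /= leq_addl.
have LN : ((2 * n).-1 <= N)%N by rewrite -subn1.
set L := (2 * n).-1 in L0 LN.
have sU a : a \in eigseq X -> U a by rewrite mem_eigseq => /XU.
have dJ : jet_on U N (remainder_jet f X) := jet_on_remainder X fU.
have [C C0 CP] := eigenvalue_perturb X.
have [d d0 sep] := separation (eigseq X).
pose b : K := \sum_(a <- eigseq X) `|a|.
have b0 : 0 <= b by rewrite sumr_ge0.
have sb a : a \in eigseq X -> `|a| <= b.
  by move=> ins; rewrite /b (big_rem a) //= lerDl sumr_ge0.
have b1 : 0 <= b + 1 by rewrite addr_ge0.
have d2 : 0 < d / 2 by rewrite divr_gt0 ?ltr0n.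
have [c c0 cP] := newton_coef_le n b1 d2.
pose B : K := n%:R * (`|X| + 1).
have B0 : 0 <= B by rewrite mulr_ge0 ?ler0n ?addr_ge0.
pose S : K := \sum_(i < n) B ^+ i.
have S0 : 0 <= S by rewrite sumr_ge0 // => i _; rewrite exprn_ge0.
(* S bounds evaluation at X + E, c the interpolant and C the displacement of
   the eigenvalues; adding 1 makes W positive. *)
pose W := S * (c * C) + 1.
have W0 : 0 < W by rewrite ltr_wpDl ?mulr_ge0 // ltW.
have [r r0 rP] : exists2 r : K, 0 < r &
    forall a z, a \in eigseq X -> `|z - a| <= r -> U z /\
      forall j, (j <= L)%N ->
        `|remainder_jet f X j z| <= eta / W * `|z - a| ^+ (L - j).
  apply: flat_jet_seq => //; last by rewrite divr_gt0.
  - by move=> j z jL; apply: dJ; apply: leq_trans LN.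
  - by move=> a /sU Ua; exact: (@remainder_jet_continuous _ _ _ _ _ _ _ fU LN Ua).
  - move=> a j aX jL; rewrite /remainder_jet osculating_polyP // ?subrr //.
    by rewrite (leq_ltn_trans jL) // /L prednK // muln_gt0.
(* r' <= 1 lets rho^(L - j) decrease to rho^n; 4 r' <= d keeps the discs apart. *)
have [r' [r'0 r'r r'1 r'd]] : exists r' : K,
    [/\ 0 < r', r' <= r, r' <= 1 & r' *+ 4 <= d].
  have d4 : 0 < d / 4%:R by rewrite divr_gt0 ?ltr0n.
  have c1 : (1 : K) >=< d / 4%:R by apply: real_comparable; apply: gtr0_real.
  have m0 : 0 < Num.min 1 (d / 4%:R) by rewrite comparable_lt_min // ltr01.
  have c2 : r >=< Num.min 1 (d / 4%:R) by apply: real_comparable; apply: gtr0_real.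
  pose m := Num.min r (Num.min 1 (d / 4%:R)).
  have : m <= m by [].
  rewrite {2}/m !comparable_le_min // => /and3P[mr m1 md].
  exists m; split=> //; first by rewrite comparable_lt_min // r0.
  by rewrite -mulr_natr -ler_pdivlMr ?ltr0n.
have rn0 : 0 < r' ^+ n / C by rewrite divr_gt0 ?exprn_gt0.
have c3 : (1 : K) >=< r' ^+ n / C by apply: real_comparable; apply: gtr0_real.
exists (Num.min 1 (r' ^+ n / C)); first by rewrite comparable_lt_min // ltr01.
move=> E El.
have [E1 EC] : `|E| <= 1 /\ C * `|E| <= r' ^+ n.
  move: El; rewrite comparable_lt_min // => /andP[/ltW-> El].
  by rewrite mulrC -ler_pdivlMr // ltW.
have CE0 : 0 <= C * `|E| by rewrite mulr_ge0 // ltW.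
have [rho rho0 rhon] : exists2 rho : K, 0 <= rho & rho ^+ n = C * `|E|.
  by exists (n.-root (C * `|E|)); rewrite ?rootC_ge0 ?rootCK.
have rhor : rho <= r'.
  by rewrite -(@ler_pXn2r _ n) ?nnegrE ?(ltW r'0) // rhon.
have rho1 : rho <= 1 by apply: le_trans r'1.
set Y := X + E.
set s := eigseq Y.
have sD a : a \in s -> balls (eigseq X) rho a.
  move=> aY; have := CP E a E1 aY; rewrite -rhon => H.
  have [||a' a'X aa'] := @exists_le_of_prod_le _ (eigseq X) a rho rho0;
    rewrite ?size_eigseq //.
  by exists a'.
have coefs k : `|(newton s (remainder_jet f X))`_k| <= c * (eta / W * rho ^+ n).
  have cl' : clustered (center (eigseq X) rho) (balls (eigseq X) rho) (b + 1) (d / 2).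
    have rhod : rho *+ 4 <= d by apply: le_trans r'd; rewrite lerMn2r rhor.
    apply: (clustered_balls rho0 d0 rhod sep) => a aX.
    by apply: lerD; first exact: sb.
  apply: (cP _ _ _ _ _ _ cl'); rewrite ?size_eigseq //.
    move=> j z jn [a aX az]; apply: (@wderiv_sub _ _ U).
      by move=> w [a' a'X aw]; have [] := rP a' w a'X (le_trans aw (le_trans rhor r'r)).
    apply: dJ; first by rewrite (leq_trans jn) // (leq_trans L0).
    by have [] := rP a z aX (le_trans az (le_trans rhor r'r)).
  move=> j z jn [a aX az].
  have [_ /(_ j)] := rP a z aX (le_trans az (le_trans rhor r'r)).
  move=> /(_ (leq_trans (ltnW jn) L0)) /le_trans; apply.
  rewrite ler_wpM2l ?divr_ge0 ?(ltW eta0) ?(ltW W0) //.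
  apply: (@le_trans _ _ (rho ^+ (L - j))); first by rewrite lerXn2r ?nnegrE.
  apply: ler_wiXn2l => //.
  rewrite leq_subRL ?(leq_trans (ltnW jn) L0) //.
  by rewrite /L mul2n -addnn -(prednK n0) addSn /= prednK // leq_add2r -ltnS prednK.
have -> : mxfun f Y = mx_horner (newton s (remainder_jet f X) + osculating_poly f X) Y.
  apply: (@mxfunE _ _ _ _ s); first by rewrite -eigseqE mx_horner_char_poly.
  move=> a j ja; rewrite derivnD hornerD (@newtonP _ _ _ _ _ ja).
  by rewrite /remainder_jet subrK.
rewrite mx_hornerD addrK.
apply: (@le_trans _ _ (S * (c * (eta / W * rho ^+ n)))).
  apply: mx_horner_le coefs.
    by rewrite (leq_trans (size_newton _ _)) // size_eigseq.
  by rewrite ler_wpM2l ?ler0n // (le_trans (ler_normD _ _)) // lerD2l.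
rewrite rhon.
have -> : S * (c * (eta / W * (C * `|E|))) = (S * (c * C) / W) * (eta * `|E|) by ring.
rewrite -[leRHS]mul1r ler_wpM2r ?mulr_ge0 // ?(ltW eta0) //.
by rewrite ler_pdivrMr // mul1r /W lerDl ler01.
Qed.

End Main.

(** * Differentiability of matrix functions *)

Section Diff.
Variable K : numFieldType.

(** The case of a zero derivative suffices, because the polynomial part of a matrix
    function is differentiated separately. *)
Lemma differentiable_flat (V W : normedModType K) (g : V -> W) x : g x = 0 ->
  (forall eta : K, 0 < eta -> exists2 del : K, 0 < del & forall h, `|h| < del ->
    `|g (x + h)| <= eta * `|h|) -> differentiable g x.
Proof.
move=> gx gP.
have H : g \o shift x = cst (g x) + (0 : V -> W) +o_ 0 id.
  apply/eqaddoP => eta eta0; have [del del0 dH] := gP eta eta0.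
  apply/nbhs_ballP; exists del => //= h; rewrite -ball_normE /= sub0r normrN.
  by rewrite gx !fctE /= addr0 subr0 [h + x]addrC; exact: dH.
apply/diff_locallyP.
have -> : 'd g x = (\0 : V -> W) :> (V -> W).
  by apply: diff_unique H; exact: cst_continuous.
by split=> //; exact: cst_continuous.
Qed.

Lemma differentiable_mx (V : normedModType K) m n (g : V -> 'M[K]_(m, n)) x :
  (forall i j, differentiable (fun v => g v i j : K) x) -> differentiable g x.
Proof.
move=> dg.
have -> : g = \sum_(i < m) \sum_(j < n)
    (fun v => (g v i j : K) *: (delta_mx i j : 'M[K]_(m, n))).
  apply/funext => v; rewrite fct_sumE [LHS]matrix_sum_delta; apply: eq_bigr => i _.
  by rewrite fct_sumE.
apply: differentiable_sum => i; apply: differentiable_sum => j.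
exact: differentiableZl.
Qed.

End Diff.

Section DiffMxfun.
Variable R : realType.
Local Notation K := (Cx R).

Lemma differentiable_mulmx (V : normedModType K) m n p (g : V -> 'M[K]_(m, n))
  (h : V -> 'M[K]_(n, p)) x : differentiable g x -> differentiable h x ->
  differentiable (fun v => g v *m h v) x.
Proof.
move=> dg dh; apply: differentiable_mx => i j.
have -> : (fun v => (g v *m h v) i j : K) =
    \sum_(k < n) (fun v => g v i k : K) * (fun v => h v k j).
  by apply/funext => v; rewrite mxE fct_sumE.
apply: differentiable_sum => k; apply: differentiableM.
  exact: (differentiable_comp dg (differentiable_coord _ i k)).
exact: (differentiable_comp dh (differentiable_coord _ k j)).
Qed.

Lemma differentiable_mx_horner n (q : {poly K}) (X : 'M[K]_n) : differentiable (mx_horner q) X.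
Proof.
have -> : mx_horner q = \sum_(i < size q) q`_i *: (fun M : 'M[K]_n => M ^+ i).
  by apply/funext => M; rewrite fct_sumE.
apply: differentiable_sum => i; apply: differentiableZ.
elim: {i}(i : nat) => [|i IH]; first exact: differentiable_cst.
under eq_fun do rewrite exprSr.
by apply: differentiable_mulmx => //; exact: ex_diff.
Qed.

Lemma differentiable_mxfun N U n f (X : 'M[K]_n) : (0 < n)%N -> (2 * n - 1 <= N)%N ->
  cont_diff_on N U f -> spec X `<=` U -> differentiable (mxfun f) X.
Proof.
move=> n0 nN fU XU.
have -> : @mxfun K f n = mx_horner (osculating_poly f X) +
    (fun Y => mxfun f Y - mx_horner (osculating_poly f X) Y).
  by apply/funext => Y; rewrite fctE addrC subrK.
apply: differentiableD; first exact: differentiable_mx_horner.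
apply: differentiable_flat; first by rewrite -mxfun_osculating subrr.
exact: (mxfun_osculating_littleo n0 nN fU XU).
Qed.

End DiffMxfun.

(** * Block matrices *)

Section Blocks.
Variable K : numClosedFieldType.

Lemma sum_mxtens (V : nmodType) p n (g : 'I_(p * n) -> V) :
  \sum_r g r = \sum_(k < p) \sum_(i < n) g (mxtens_index (k, i)).
Proof.
rewrite pair_bigA (reindex (@mxtens_index p n)) /=; last first.
  by apply: onW_bij; exists (@mxtens_unindex p n);
    [exact: mxtens_indexK|exact: mxtens_unindexK].
by apply: eq_bigr => -[k i].
Qed.

Lemma tensor_rowsP p n m (X Y : 'M[K]_(p * n, m)) :
  (forall k i j, X (mxtens_index (k, i)) j = Y (mxtens_index (k, i)) j) -> X = Y.
Proof.
move=> XY; apply/matrixP => r j; rewrite -(mxtens_unindexK r).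
by case: mxtens_unindex => k i; apply: XY.
Qed.

Lemma tens1_mulE p n m (F : 'M[K]_p) (X : 'M[K]_(p * n, m)) k i j :
  ((F *t 1%:M) *m X) (mxtens_index (k, i)) j =
  \sum_r F k r * X (mxtens_index (r, i)) j.
Proof.
rewrite mxE sum_mxtens; apply: eq_bigr => r _.
rewrite (bigD1 i) //= big1 ?addr0 => [|a ai]; rewrite tensmxE mxE.
  by rewrite eqxx mulr1.
by rewrite eq_sym (negPf ai) mulr0 mul0r.
Qed.

Lemma blkdiag_mulE p n m (B : 'I_p -> 'M[K]_n) (X : 'M[K]_(p * n, m)) k i j :
  (blkdiag B *m X) (mxtens_index (k, i)) j =
  \sum_a B k i a * X (mxtens_index (k, a)) j.
Proof.
rewrite mxE sum_mxtens (bigD1 k) //= [X in _ + X]big1 ?addr0 => [|l lk].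
  by apply: eq_bigr => a _; rewrite blkdiagE eqxx.
by rewrite big1 // => a _; rewrite blkdiagE eq_sym (negPf lk) mul0r.
Qed.

Lemma blkdiag_blkcol p n m (B : 'I_p -> 'M[K]_n) (X : 'I_p -> 'M[K]_(n, m)) :
  blkdiag B *m blkcol X = blkcol (fun k => B k *m X k).
Proof.
apply: tensor_rowsP => k i j; rewrite blkdiag_mulE mxE mxtens_indexK /= mxE.
by apply: eq_bigr => a _; rewrite mxE mxtens_indexK.
Qed.

Lemma blkdiag_inj p n : injective (@blkdiag K n p).
Proof.
move=> B B' BB; apply/funext => k; apply/matrixP => i j.
have /matrixP/(_ (mxtens_index (k, i)) (mxtens_index (k, j))) := BB.
by rewrite !blkdiagE eqxx.
Qed.

Lemma eigenvalue_blkdiag p n (B : 'I_p -> 'M[K]_n) k a :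
  eigenvalue (B k) a -> eigenvalue (blkdiag B) a.
Proof.
move=> /eigenvalueP[v vB v0]; apply/eigenvalueP.
pose u : 'rV[K]_(p * n) := \row_r
  (if (mxtens_unindex r).1 == k then v 0 (mxtens_unindex r).2 else 0).
exists u.
  apply/rowP => r; rewrite -(mxtens_unindexK r); case: mxtens_unindex => l j.
  rewrite !mxE sum_mxtens mxtens_indexK /= (bigD1 k) //=.
  rewrite [X in _ + X]big1 ?addr0 => [|s sk]; last first.
    by rewrite big1 // => i _; rewrite !mxE mxtens_indexK /= (negPf sk) mul0r.
  under eq_bigr => i _ do rewrite !mxE mxtens_indexK /= eqxx blkdiagE.
  case: (eqVneq l k) => _; last by rewrite mulr0 big1 // => i _; rewrite mulr0.
  by have /rowP/(_ j) := vB; rewrite !mxE.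
apply: contra v0 => /eqP u0; apply/eqP/rowP => j.
have /rowP/(_ (mxtens_index (k, j))) := u0.
by rewrite !mxE mxtens_indexK /= eqxx.
Qed.

End Blocks.

(** * The discrete Fourier transform and block circulant matrices *)

Section DFT.
Variables (R : realType) (p : nat).
Local Notation K := (Cx R).

Definition cis (t : R) : K := (cos t +i* sin t)%C.

Definition root_unity (m : nat) : K := cis (- (2 * pi * m%:R / p%:R)).

Lemma cisD s t : cis (s + t) = cis s * cis t.
Proof. by rewrite /cis cosD sinD; simpc; rewrite [sin s * _ + _]addrC. Qed.

Lemma cis_conj t : Num.conj (cis t) = cis (- t).
Proof. by rewrite /cis cosN sinN. Qed.

Lemma cis0 : cis 0 = 1.
Proof. by rewrite /cis cos0 sin0. Qed.

Lemma dftE j k : dft R p j k = (sqrtC p%:R)^-1 * root_unity (j * k).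
Proof. by rewrite mxE. Qed.

Hypothesis p_gt0 : (0 < p)%N.
Let p0 : p%:R != 0 :> R.
Proof. by rewrite pnatr_eq0 -lt0n. Qed.

Lemma root_unityD m n : root_unity (m + n) = root_unity m * root_unity n.
Proof. by rewrite /root_unity -cisD natrD mulrDr mulrDl opprD. Qed.

Lemma root_unity0 : root_unity 0 = 1.
Proof. by rewrite /root_unity mulr0 mul0r oppr0 cis0. Qed.

Lemma root_unityX m n : root_unity (m * n) = root_unity m ^+ n.
Proof.
by elim: n => [|n IH]; rewrite ?muln0 ?root_unity0 // mulnS root_unityD IH exprS.
Qed.

Lemma root_unityp : root_unity p = 1.
Proof.
rewrite /root_unity mulfK // /cis cosN sinN mulr_natl cos2pi sin2pi oppr0.
by [].
Qed.

Lemma root_unity_mod m : root_unity (m %% p) = root_unity m.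
Proof.
by rewrite [in RHS](divn_eq m p) root_unityD mulnC root_unityX root_unityp expr1n mul1r.
Qed.

Lemma root_unity_mul_conj m : root_unity m * Num.conj (root_unity m) = 1.
Proof. by rewrite cis_conj -cisD subrr cis0. Qed.

(** If cos t = 1 then sin (t / 2) = 0, which is impossible for t / 2 strictly
    between 0 and pi. *)
Lemma root_unity_neq1 m : (0 < m < p)%N -> root_unity m != 1.
Proof.
move=> /andP[m0 mp]; apply/eqP => -[].
set t := 2 * pi * m%:R / p%:R.
rewrite cosN => c1 _.
pose u := t / 2.
have tu : t = u *+ 2 by rewrite -mulr_natr divfK // pnatr_eq0.
have uE : u = pi * (m%:R / p%:R) by rewrite /u /t; field.
have : 0 < sin u.
  apply: sin_gt0_pi; rewrite uE mulr_gt0 ?pi_gt0 ?divr_gt0 ?ltr0n //=.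
  by rewrite gtr_pMr ?pi_gt0 // ltr_pdivrMr ?ltr0n // mul1r ltr_nat.
move: c1; rewrite tu cos_mulr2n cos2sin2 => c1.
suff -> : sin u = 0 by rewrite ltxx.
apply/eqP; rewrite -sqrf_eq0.
have : sin u ^+ 2 *+ 2 = 0.
  have -> : sin u ^+ 2 *+ 2 = 1 - ((1 - sin u ^+ 2) *+ 2 - 1) by ring.
  by rewrite c1 subrr.
by move/eqP; rewrite mulrn_eq0.
Qed.

Lemma sum_root_unity (j l : 'I_p) :
  \sum_(k < p) root_unity (j * k) * Num.conj (root_unity (l * k)) =
  (j == l)%:R * p%:R.
Proof.
pose w := root_unity j * Num.conj (root_unity l).
have wE k : root_unity (j * k) * Num.conj (root_unity (l * k)) = w ^+ k.
  by rewrite !root_unityX rmorphXn -exprMn.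
under eq_bigr => k _ do rewrite wE.
have wp : w ^+ p = 1.
  by rewrite -wE !(mulnC _ p) !root_unityX !root_unityp !expr1n rmorph1 mulr1.
case: eqVneq => [jl|jl].
  rewrite mul1r /w jl root_unity_mul_conj.
  by under eq_bigr => k _ do rewrite expr1n; rewrite sumr_const card_ord.
have w1 : w - 1 != 0.
  rewrite subr_eq0; apply: contra jl => /eqP w1.
  have {w1} : root_unity j = root_unity l.
    by rewrite -[LHS]mulr1 -(root_unity_mul_conj l) mulrCA -/w w1 mulr1.
  wlog jl : j l {w wE wp} / (j <= l)%N => [H E|E].
    by case: (leqP j l) => [/H|/ltnW/H]; [apply|rewrite eq_sym; apply].
  apply/eqP/val_inj/eqP => /=; rewrite eqn_leq jl leqNgt; apply/negP => lj.
  have : root_unity (l - j) = 1.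
    have := root_unity_mul_conj j; rewrite {1}E -{1}(subnK jl) root_unityD -mulrA.
    by rewrite root_unity_mul_conj mulr1.
  apply/eqP/root_unity_neq1.
  by rewrite subn_gt0 lj (leq_ltn_trans (leq_subr _ _)).
by rewrite mul0r; apply: (mulfI w1); rewrite mulr0 -subrX1 wp subrr.
Qed.

Lemma dft_unitary : dft R p *m ctrmx (dft R p) = 1%:M.
Proof.
have sp : sqrtC (p%:R : K) != 0 by rewrite sqrtC_eq0 pnatr_eq0 -lt0n.
apply/matrixP => j l; rewrite mxE [RHS]mxE.
under eq_bigr => k _.
  rewrite [X in _ * X]mxE [X in _ * Num.conj X]mxE !dftE rmorphM /= mulrACA.
  over.
rewrite -mulr_sumr sum_root_unity.
rewrite (CrealP _); last by rewrite realV ger0_real // sqrtC_ge0 ler0n.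
by rewrite -invfM -expr2 sqrtCK mulrCA mulVf ?mulr1 // pnatr_eq0 -lt0n.
Qed.

(** The k-th diagonal block of the transformed block circulant matrix. *)
Definition dft_block n (A : tensor K n n p) (k : 'I_p) : 'M[K]_n :=
  \sum_(s < p) root_unity (k * s) *: A s.

Lemma cyc_sub_inj (l : 'I_p) : injective (fun r : 'I_p => cyc_sub r l).
Proof.
move=> r r' /(congr1 val) /= /eqP; rewrite eqn_modDr !modn_small //.
by move/eqP/val_inj.
Qed.

(** The convolution theorem: substituting r = s + l mod p in the row index of a
    block circulant matrix splits the root of unity of exponent k r into the
    factors of exponents k s and k l. *)
Lemma dft_bcirc n (A : tensor K n n p) :
  (dft R p *t 1%:M) *m bcirc A = blkdiag (dft_block A) *m (dft R p *t 1%:M).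
Proof.
apply: tensor_rowsP => k i c; rewrite -(mxtens_unindexK c).
case: (mxtens_unindex c) => l j.
rewrite tens1_mulE blkdiag_mulE (bigD1 j) //=.
rewrite [X in _ = _ + X]big1 => [|a aj]; last first.
  by rewrite tensmxE [X in _ * (_ * X)]mxE (negPf aj) !mulr0.
rewrite addr0 tensmxE [X in _ * (_ * X)]mxE eqxx mulr1 summxE mulr_suml.
rewrite [RHS](reindex_inj (@cyc_sub_inj l)); apply: eq_bigr => r _.
rewrite !dftE [bcirc _ _ _]mxE !mxtens_indexK /= mxE.
set a := (A _ i j); set sp := (sqrtC _)^-1.
have -> : root_unity (k * r) = root_unity (k * cyc_sub r l) * root_unity (k * l).
  rewrite -root_unityD -mulnDr -root_unity_mod -[RHS]root_unity_mod.
  congr root_unity; rewrite -[RHS]modnMmr /= modnDml -addnA.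
  rewrite subnK ?(ltnW (ltn_ord l)) //.
  by rewrite modnDr modnMmr.
by ring.
Qed.

End DFT.

(** * Derivative of the tensor t-function *)

Section Linear.
Variable K : numFieldType.

Lemma is_diff_linear (V W : normedModType K) (g : V -> W) (c : K) x :
  linear g -> 0 <= c -> (forall v, `|g v| <= c * `|v|) -> is_diff x g g.
Proof.
move=> lg c0 gc.
pose gM := GRing.isLinear.Build _ _ _ _ _ lg.
pose gL : {linear V -> W} := HB.pack g gM.
have cg : continuous gL.
  move=> y; apply/cvgrPdist_lt => e e0.
  have c1 : 0 < c + 1 by rewrite ltr_wpDl.
  apply/nbhs_ballP; exists (e / (c + 1)); first by rewrite /= divr_gt0.
  move=> z; rewrite -ball_normE /= ltr_pdivlMr // => yz.
  rewrite -[g y - g z]/(gL y - gL z) -raddfB /=.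
  apply: le_lt_trans (gc _) (le_lt_trans _ yz).
  by rewrite mulrC ler_wpM2l // lerDl.
by apply: DiffDef; [exact: (linear_differentiable _ cg)|exact: (diff_lin _ cg)].
Qed.

(** A linear map on matrices is bounded by the norms of its values at the matrix
    units. *)
Lemma is_diff_linear_mx (W : normedModType K) m n (g : 'M[K]_(m, n) -> W) x :
  linear g -> is_diff x g g.
Proof.
move=> lg; apply: (@is_diff_linear _ _ _ (\sum_i \sum_j `|g (delta_mx i j)|)) => //.
  by rewrite sumr_ge0 // => i _; rewrite sumr_ge0.
move=> M.
pose gM := GRing.isLinear.Build _ _ _ _ _ lg.
pose gL : {linear 'M[K]_(m, n) -> W} := HB.pack g gM.
rewrite [M in leLHS]matrix_sum_delta -[g _]/(gL _) raddf_sum.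
rewrite (le_trans (ler_norm_sum _ _ _)) // mulr_suml; apply: ler_sum => i _.
rewrite raddf_sum (le_trans (ler_norm_sum _ _ _)) // mulr_suml; apply: ler_sum => j _.
rewrite [X in `|X| <= _](_ : _ = M i j *: g (delta_mx i j)); last exact: (linearZZ gL).
by rewrite normrZ mulrC ler_wpM2l // mx_norm_entry.
Qed.

Lemma is_diff_sum (V W : normedModType K) n (g dg : 'I_n -> V -> W) x :
  (forall i, is_diff x (g i) (dg i)) ->
  is_diff x (\sum_(i < n) g i) (\sum_(i < n) dg i).
Proof.
move=> gP; elim/big_ind2: _ => [|a b c d ab cd|i _]; last exact: gP.
  exact: is_diff_cst.
exact: is_diffD.
Qed.

End Linear.

Section Tensor.
Variable K : numClosedFieldType.

Lemma tensor_entry n m p (X : tensor K n m p) k i j : `|X k i j| <= `|X|.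
Proof.
have sq_ge0 (t : 'I_p * ('I_n * 'I_m)) : 0 <= `|X t.1 t.2.1 t.2.2| ^+ 2.
  exact: exprn_ge0.
rewrite [leRHS]/Num.Def.normr /= frobE -[leLHS]sqrCK //.
rewrite ler_sqrtC ?nnegrE ?exprn_ge0 //; last exact: sumr_ge0.
by rewrite (bigD1 (k, (i, j))) //= lerDl; apply: sumr_ge0.
Qed.

Lemma tensor_slice n m p (X : tensor K n m p) k : `|X k| <= `|X|.
Proof. by apply: mx_norm_le => // i j; exact: tensor_entry. Qed.

End Tensor.

Section Assembly.
Variables (R : realType) (p : nat).
Local Notation K := (Cx R).
Hypothesis p_gt0 : (0 < p)%N.
Local Notation F n := (dft R p *t (1%:M : 'M[K]_n)).
Local Notation FH n := (ctrmx (dft R p) *t (1%:M : 'M[K]_n)).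

Lemma tens_dft_unitary n : F n *m FH n = 1%:M.
Proof.
rewrite tensmx_mul mulmx1 dft_unitary //; apply: tensor_rowsP => k i c.
rewrite -(mxtens_unindexK c); case: mxtens_unindex => l j.
rewrite tensmxE !mxE (can_eq (@mxtens_indexK _ _)) xpair_eqE.
by case: eqP; rewrite ?mul1r ?mul0r.
Qed.

Lemma dft_E1 n : F n *m E1 K n p = blkcol (fun _ => (sqrtC p%:R)^-1 *: 1%:M).
Proof.
apply: tensor_rowsP => k i j; rewrite tens1_mulE [RHS]mxE mxtens_indexK /= [RHS]mxE.
rewrite (bigD1 (Ordinal p_gt0)) //= big1 ?addr0 => [|r r0].
  by rewrite dftE muln0 root_unity0 mulr1 mxE mxtens_indexK /= mul1r.
rewrite [X in _ * X]mxE mxtens_indexK /=; case: eqP => [r0'|]; last by rewrite mul0r mulr0.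
by case/eqP: r0; apply: val_inj.
Qed.

Lemma dft_bcirc_conj n (A : tensor K n n p) :
  F n *m bcirc A *m FH n = blkdiag (dft_block A).
Proof. by rewrite dft_bcirc // -mulmxA tens_dft_unitary mulmx1. Qed.

Lemma bcircE n (A : tensor K n n p) :
  bcirc A = FH n *m blkdiag (dft_block A) *m F n.
Proof.
rewrite -dft_bcirc_conj !mulmxA (mulmx1C (tens_dft_unitary n)) mul1mx.
by rewrite -mulmxA (mulmx1C (tens_dft_unitary n)) mulmx1.
Qed.

(** The contribution of the k-th diagonal block M of the transformed matrix to the
    tensor. *)
Definition lift_block n (k : 'I_p) (M : 'M[K]_n) : tensor K n n p :=
  fold (FH n *m blkcol (fun l => if l == k then (sqrtC p%:R)^-1 *: M else 0)).

Lemma lift_block_linear n k : linear (@lift_block n k).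
Proof.
move=> c M N; apply/ffunP => l; apply/matrixP => i j.
rewrite /lift_block /fold !ffunE !mxE mulr_sumr -big_split /=; apply: eq_bigr => r _.
rewrite ![blkcol _ _ _]mxE; case: eqP => _; rewrite !mxE ?mulr0 ?addr0 //.
by ring.
Qed.

Lemma fold_blkcol_sum n (B : 'I_p -> 'M[K]_n) :
  fold (FH n *m blkcol (fun k => (sqrtC p%:R)^-1 *: B k)) = \sum_k lift_block k (B k).
Proof.
apply/ffunP => l; apply/matrixP => i j; rewrite sum_ffunE summxE !ffunE mxE.
under [RHS]eq_bigr => k _ do rewrite ffunE mxE mxE.
rewrite [LHS]mxE exchange_big; apply: eq_bigr => r _.
rewrite -mulr_sumr; congr (_ * _); rewrite [LHS]mxE.
under eq_bigr => k _ do rewrite mxE.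
rewrite (bigD1 (mxtens_unindex r).1) //= eqxx big1 ?addr0 // => k /negPf.
by rewrite eq_sym => ->; rewrite mxE.
Qed.

Lemma tfunE n (f : K -> K) (A : tensor K n n p) :
  tfun f A = \sum_k lift_block k (mxfun f (dft_block A k)).
Proof.
rewrite -fold_blkcol_sum /tfun bcircE mxfun_conj ?tens_dft_unitary //.
rewrite mxfun_blkdiag -mulmxA dft_E1 -mulmxA blkdiag_blkcol.
congr (fold (_ *m blkcol _)); apply/funext => k.
by rewrite -scalemxAr mulmx1.
Qed.

Lemma is_diff_dft_block n (k : 'I_p) (A : tensor K n n p) :
  is_diff A (fun B => dft_block B k) (fun B => dft_block B k).
Proof.
apply: (@is_diff_linear K (tensor K n n p) 'M[K]_n _ (\sum_(s < p) `|root_unity R p (k * s)|)).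
- move=> c B B'; rewrite /dft_block scaler_sumr -big_split; apply: eq_bigr => s _.
  by rewrite !ffunE scalerDr !scalerA mulrC.
- by rewrite sumr_ge0.
move=> B; rewrite (le_trans (ler_norm_sum _ _ _)) // mulr_suml.
apply: ler_sum => s _; rewrite normrZ ler_wpM2l //; exact: tensor_slice.
Qed.

End Assembly.

Theorem corollary1 (R : realType) (n p : nat) (n_gt0 : (0 < n)%N)
    (p_gt0 : (0 < p)%N) (A C : tensor (Cx R) n n p)
    (f : Cx R -> Cx R) (U : set (Cx R))
    (fU : cont_diff_on (2 * n * p - 1) U f)
    (AU : spec (bcirc A) `<=` U)
    (DA DC : 'I_p -> 'M[Cx R]_n)
    (hA : (dft R p *t 1%:M) *m bcirc A *m (ctrmx (dft R p) *t 1%:M)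
          = blkdiag DA)
    (hC : (dft R p *t 1%:M) *m bcirc C *m (ctrmx (dft R p) *t 1%:M)
          = blkdiag DC) :
  [/\ differentiable (tfun f) A,
      forall i : 'I_p, differentiable (mxfun f) (DA i)
    & 'd (tfun f) A C
      = fold ((ctrmx (dft R p) *t 1%:M) *m
              blkcol (fun i : 'I_p => (sqrtC p%:R)^-1 *:
                        'd (mxfun f) (DA i) (DC i)))].
Proof.
have DAE : DA = dft_block A by apply: blkdiag_inj; rewrite -hA dft_bcirc_conj.
have DCE : DC = dft_block C by apply: blkdiag_inj; rewrite -hC dft_bcirc_conj.
have dDA i : differentiable (mxfun f) (DA i).
  apply: (differentiable_mxfun n_gt0 _ fU).
    by rewrite leq_sub2r // leq_pmulr.
  move=> a /= ia; apply: AU; rewrite /spec /=.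
  have /eigenvalueP[v vD v0] := eigenvalue_blkdiag ia.
  have Fu := tens_dft_unitary R p_gt0 n.
  apply/eigenvalueP; exists (v *m (dft R p *t 1%:M)).
    by rewrite -mulmxA dft_bcirc // -DAE mulmxA vD scalemxAl.
  apply: contra v0 => /eqP v0; apply/eqP.
  by rewrite -[v]mulmx1 -Fu mulmxA v0 mul0mx.
have dT : is_diff A (tfun f) (\sum_(k < p)
    (@lift_block R p n k \o ('d (mxfun f) (DA k) \o (fun B => dft_block B k)))).
  have -> : tfun f = \sum_(k < p)
     (@lift_block R p n k \o (mxfun f \o (fun B => dft_block B k))).
    by apply/funext => B; rewrite tfunE // fct_sumE.
  apply: is_diff_sum => k; apply: is_diff_comp.
    apply: is_diff_comp; first exact: is_diff_dft_block.
    rewrite -DAE; exact: differentiableP.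
  exact/is_diff_linear_mx/lift_block_linear.
split=> //.
rewrite diff_val fct_sumE fold_blkcol_sum; apply: eq_bigr => k _ /=.
by rewrite DCE.
Qed.
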